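(* Let $X=(X,d,\mu)$ be an unbounded metric space equipped with a doubling measure $\mu$ such that $\mu(\{x\})=0$ for every $x\in X$, and such that the annulus $B(x,R)\setminus B(x,r)$ is non-empty for each $x\in X$ and all $0<r<R<\infty$. Let $0<s<1$. Assume that $X$ satisfies the $1$-chain condition, that there is a constant $C^*>0$ such that the reverse doubling condition $$\frac{\mu(B(y,r))}{\mu(B(x,R))}\le C^*\Bigl(\frac rR\Bigr)^{s}$$ holds whenever $B(y,r)\subset B(x,R)\subset X$, and that there are $Q>s$ and $c>0$ such that $\mu(B)\ge c\operatorname{rad}(B)^Q$ for all balls $B\subset X$. Let $\emptyset\neq E\subset X$ be a closed set, write $\delta_E(x)=\operatorname{dist}(x,E)$, and let $1<p\le q\le Qp/(Q-sp)<\infty$ and $\beta\in\mathbb{R}$ be such that $$\underline{\mathrm{co\,dim}}_A(E)>\max\Bigl\{Q-\frac qp(Q-sp+\beta),\ \frac{\beta}{p-1}\Bigr\}.$$ Then, if $1\le t<\infty$, there is a constant $C>0$ such that the fractional Hardy--Sobolev inequality $$\Bigl(\int_X|f(x)|^q\,\delta_E(x)^{(q/p)(Q-sp+\beta)-Q}\,d\mu(x)\Bigr)^{1/q}\le C\Bigl(\int_X\Bigl(\int_X\frac{|f(y)-f(z)|^t}{d(y,z)^{st}\,\mu(B(y,d(y,z)))}\,d\mu(z)\Bigr)^{p/t}\delta_E(y)^{\beta}\,d\mu(y)\Bigr)^{1/p}$$ holds for every $f\in\operatorname{Lip}_0(X)$.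
   Context: $X=(X,d,\mu)$ is a metric space with a Borel measure $\mu$ supported on $X$ such that $0<\mu(B)<\infty$ for every open ball $B=B(x,r)=\{y\in X:d(x,y)<r\}$, $x\in X$, $r>0$. Each ball $B$ comes with a fixed center $x_B$ and radius $\operatorname{rad}(B)$, and $\ell B=B(x_B,\ell\operatorname{rad}(B))$ for $\ell>0$. The measure $\mu$ is doubling: there is $C_D>0$ with $\mu(B(x,2r))\le C_D\,\mu(B(x,r))$ for all $x\in X$, $r>0$. Chain condition: for $\lambda\ge1$, $X$ satisfies the $\lambda$-chain condition if there is a constant $M\ge1$ such that for each $x\in X$ and all $0<r<R$ there is a sequence of balls $B_0,B_1,\dots,B_k$, for some integer $k$, with: (A) $\lambda B_0\subset X\setminus B(x,R)$ and $\lambda B_k\subset B(x,r)$; (B) $M^{-1}\operatorname{diam}(\lambda B_i)\le\operatorname{dist}(x,\lambda B_i)\le M\operatorname{diam}(\lambda B_i)$ for $i=0,\dots,k$; (C) there is a ball $R_i\subset B_i\cap B_{i+1}$ such that $B_i\cup B_{i+1}\subset MR_i$ for $i=0,\dots,k-1$; (D) no point of $X$ belongs to more than $M$ of the balls $\lambda B_i$. For $E\subset X$ and $r>0$ let $E_r=\{x\in X:\operatorname{dist}(x,E)<r\}$. The lower Assouad codimension $\underline{\mathrm{co\,dim}}_A(E)$ is the supremum of all $\rho\ge0$ for which there is a constant $C\ge1$ such that $\mu(E_r\cap B(x,R))/\mu(B(x,R))\le C(r/R)^{\rho}$ for every $x\in E$ and all $0<r<R<2\operatorname{diam}(X)$.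 $\operatorname{Lip}_0(X)$ is the set of all Lipschitz functions $f\colon X\to\mathbb{R}$ for which there is a ball $B$ with $f=0$ on $X\setminus B$. The constant $C$ in the inequality is independent of $f$; the inner integral is understood over $z\ne y$. *)

(* Defs.v *)
From HB Require Import structures.
From mathcomp Require Import all_boot all_order all_algebra.
From mathcomp Require Import all_classical all_reals all_analysis.
Import Order.TTheory GRing.Theory Num.Theory.
Import numFieldNormedType.Exports.

Set Implicit Arguments.
Unset Strict Implicit.
Unset Printing Implicit Defensive.

Local Open Scope classical_set_scope.
Local Open Scope ring_scope.

(* The two structures are a priori unrelated: that the sigma-algebra is the
   Borel one has to be stated separately, see [borel_sigma_algebra].
   MathComp's measurable types are pointed, hence nonempty. *)
#[short(type="measurableMetricType")]
HB.structure Definition MeasurableMetric d (R : numDomainType) :=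
  { T of Measurable d T & Metric R T }.

Definition borel_sigma_algebra d (R : realType)
    (X : measurableMetricType d R) : Prop :=
  (measurable : set (set X)) = <<s [set U : set X | open U] >>.

Section metric_notions.
Context {R : realType} {X : metricType R}.
Implicit Types (x : X) (A E : set X).

(* Extended-real valued, so that an unbounded set has diameter +oo. *)
Definition diam A : \bar R :=
  ereal_sup [set (mdist xy.1 xy.2)%:E | xy in A `*` A].

(* Meaningful for nonempty A only: dist x set0 = 0. *)
Definition dist x A : R := inf [set mdist x y | y in A].

Definition neighborhood E (r : R) : set X := [set x | dist x E < r].

(* dist(x,E)^a as an extended real: unlike for [powR], 0^a = +oo if a < 0. *)
Definition dist_pow E (a : R) x : \bar R :=
  if (dist x E == 0) && (a < 0) then +oo%E else (dist x E `^ a)%:E.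

Definition Lip0 (f : X -> R) : Prop :=
  (exists L : R, forall x y, `|f x - f y| <= L * mdist x y) /\
  (exists (x : X) (r : R), 0 < r /\ forall y, ~ ball x r y -> f y = 0).

End metric_notions.

(* A ball as center and radius: the point set need not determine them. *)
Record cball (R : realType) (X : metricType R) := CBall {
  center : X;
  rad : R;
  rad_gt0 : 0 < rad }.

Definition dilate (R : realType) (X : metricType R) (l : R) (B : cball X) :
  set X := ball (center B) (l * rad B).

Definition cball_set (R : realType) (X : metricType R) (B : cball X) : set X :=
  ball (center B) (rad B).
Coercion cball_set : cball >-> set.

(* Only the terms B 0, ..., B k of the sequence B are relevant; the last clause
   bounds the number of indices i <= k such that y is in lambda B_i. *)
Definition chain_condition (R : realType) (X : metricType R) (lambda : R) :
    Prop :=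
  exists M : R, 1 <= M /\
  forall (x : X) (r R0 : R), 0 < r -> r < R0 ->
  exists (k : nat) (B : nat -> cball X),
    [/\ dilate lambda (B 0%N) `<=` ~` ball x R0 /\
          dilate lambda (B k) `<=` ball x r,
        forall i, (i <= k)%N ->
          (M^-1%:E * diam (dilate lambda (B i)) <=
             (dist x (dilate lambda (B i)))%:E)%E /\
          ((dist x (dilate lambda (B i)))%:E <=
             M%:E * diam (dilate lambda (B i)))%E,
        forall i, (i < k)%N -> exists B' : cball X,
          (B' `<=` B i `&` B i.+1) /\ (B i `|` B i.+1 `<=` dilate M B') &
        forall y : X,
          \sum_(i < k.+1) \1_(dilate lambda (B i)) y <= M].

Section measure_notions.
Context d (R : realType) (X : measurableMetricType d R).
Variable mu : {measure set X -> \bar R}.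

Definition ball_measure_pos_fin : Prop :=
  forall (x : X) (r : R), 0 < r -> (0 < mu (ball x r) < +oo)%E.

Definition doubling : Prop :=
  exists CD : R, 0 < CD /\
  forall (x : X) (r : R), 0 < r ->
    (mu (ball x (2 * r)) <= CD%:E * mu (ball x r))%E.

Definition reverse_doubling (s : R) : Prop :=
  exists Cstar : R, 0 < Cstar /\
  forall (x y : X) (r R0 : R), 0 < r -> 0 < R0 ->
    ball y r `<=` ball x R0 ->
    (mu (ball y r) / mu (ball x R0) <= (Cstar * (r / R0) `^ s)%:E)%E.

Definition lower_assouad_codim (E : set X) : \bar R :=
  ereal_sup [set rho%:E | rho in [set rho : R | 0 <= rho /\
    exists C : R, 1 <= C /\
    forall (x : X) (r R0 : R), E x -> 0 < r -> r < R0 ->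
      (R0%:E < 2%:E * diam [set: X])%E ->
      (mu (neighborhood E r `&` ball x R0) / mu (ball x R0) <=
         (C * (r / R0) `^ rho)%:E)%E]].

Definition weighted_norm_lhs (E : set X) (Q s p q beta : R) (f : X -> R) :
    \bar R :=
  ((\int[mu]_(x in [set: X])
      ((`|f x| `^ q)%:E * dist_pow E (q / p * (Q - s * p + beta) - Q) x))
   `^ q^-1)%E.

Definition weighted_seminorm_rhs (E : set X) (s p t beta : R) (f : X -> R) :
    \bar R :=
  ((\int[mu]_(y in [set: X])
      ((\int[mu]_(z in ~` [set y])
          ((`|f y - f z| `^ t)%:E /
             ((mdist y z `^ (s * t))%:E * mu (ball y (mdist y z)))))
         `^ (p / t) * dist_pow E beta y))
   `^ p^-1)%E.

End measure_notions.

(* Main.v *)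
Require Import Defs.
From HB Require Import structures.
From mathcomp Require Import all_boot all_order all_algebra.
From mathcomp Require Import all_classical all_reals all_analysis.
From mathcomp Require Import measurable_realfun measurable_fun_approximation.
From mathcomp Require Import ring lra.
Import Order.TTheory GRing.Theory Num.Theory.
Import numFieldNormedType.Exports.

(** Write [D x] for the distance of [x] to [E] and
    [alpha = q / p * (Q - s * p + beta) - Q] for the exponent on the left.

    The seminorm controls a simpler object.  Let [A x r] be the average of [f]
    over [ball x r] and let [h y] be the supremum of
    [r ^ (- s) * |A x r - A x (2 r)|] over the balls [ball x r] that contain [y].
    As these balls are open, [h] is lower semicontinuous; and [h] is at most a
    constant times the inner seminorm, whatever [t >= 1] is
    ([avg_gradient_le]).  It remains to bound the integral of
    [|f| ^ q * D ^ alpha] by a constant times [J ^ (q / p)], where [J] is an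
    upper bound of the energy, the integral of [h ^ p * D ^ beta]
    ([integral_dist_pow_le]).

    Fix [x] off [E] and [r] comparable to [D x].  Since averages over large balls
    tend to [0], [f x] is the sum of the local part [f x - A x r] and of the
    steps [A x (2 ^ n r) - A x (2 ^ (n + 1) r)], [n >= 0].  Either the local part
    is at least [|f x| / 4], or some step is at least a fixed multiple of
    [2 ^ (- n z) * |f x|], with [z > 0] at our disposal ([large_step]).

    In the local part the weights are essentially constant.  The averages give
    [|f x - A x t| <= C t ^ s * h x] for every [t], while the steps between [t]
    and [r] are bounded through the energy and the lower mass bound; balancing
    the two as in Hedberg's proof of the Sobolev inequality gives
    [|f x - A x r| ^ q * D ^ alpha <= C h x ^ p * D ^ beta * J ^ (q / p - 1)]
    ([whitney_pointwise_le]), which includes the critical exponent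
    [q = Q p / (Q - s p)].  The definition of [h] makes it play the part of the
    maximal function.

    A step at scale [r] is bounded by [r ^ s * h] on all of [ball x r], hence by
    a mean of [h] for any weight.  With a weight that decays away from the
    distance [r] to [E], this bounds its [q]-th power linearly by the energy
    near distance [r] in a ball of radius [2 r], the surplus power [q / p - 1]
    being absorbed in [J] ([global_step_le]).  Integrating over a net of balls of
    radius [r] costs the integral of [D ^ (alpha - z)] over balls near [E], which
    the codimension controls ([integral_dist_powN_le]).  Finally the balls of a
    net overlap boundedly by doubling, and the energies of the scales sum up to
    at most a multiple of the whole energy ([scales_overlap]). *)

Set Implicit Arguments.
Unset Strict Implicit.
Unset Printing Implicit Defensive.

Local Open Scope classical_set_scope.
Local Open Scope ring_scope.


(** * Distance to a set *)

Section distance_to_a_set.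
Context {R : realType} {X : metricType R}.
Implicit Types (x y z : X) (E : set X).

Lemma in_ball x r y : ball x r y <-> mdist x y < r.
Proof. by rewrite ballEmdist. Qed.

Lemma ball_sub x y (r r' : R) : mdist x y + r <= r' -> ball y r `<=` ball x r'.
Proof.
move=> h z /in_ball yz; apply/in_ball.
by have := metric_triangle x y z; lra.
Qed.

Lemma open_mball x r : open (ball x r).
Proof.
rewrite openE => y /in_ball xy; apply/nbhs_ballP.
by exists (r - mdist x y); [rewrite /= subr_gt0 | apply: ball_sub; lra].
Qed.

Lemma dist_ge0 E x : 0 <= dist x E.
Proof.
have [->|/set0P E0] := eqVneq E set0; first by rewrite /dist image_set0 inf0.
apply: lb_le_inf; first exact: image_nonempty.
by move=> _ [y _ <-]; exact: mdist_ge0.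
Qed.

Lemma dist_le E x y : E y -> dist x E <= mdist x y.
Proof.
move=> Ey; apply: ge_inf; last by exists y.
by exists 0 => _ [z _ <-]; exact: mdist_ge0.
Qed.

Lemma dist_lt_ex E x (r : R) : E !=set0 -> dist x E < r ->
  exists2 e, E e & mdist x e < r.
Proof.
move=> E0 /inf_lt[|_ [e Ee <-] xe]; first exact: image_nonempty.
by exists e.
Qed.

Lemma dist_triangle E x y : E !=set0 -> dist x E <= mdist x y + dist y E.
Proof.
move=> E0; apply/ler_addgt0Pl => e e0.
have [z Ez yz] : exists2 z, E z & mdist y z < dist y E + e.
  by apply: dist_lt_ex => //; rewrite ltrDl.
by have := dist_le x Ez; have := metric_triangle x y z; lra.
Qed.

Lemma open_dist_lt E (r : R) : E !=set0 -> open [set x | dist x E < r].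
Proof.
move=> E0; rewrite openE => x /= xr; apply/nbhs_ballP.
exists (r - dist x E); rewrite /= ?subr_gt0 // => y /in_ball xy /=.
by have := dist_triangle y x E0; rewrite (metric_sym y x); lra.
Qed.

End distance_to_a_set.

(** * Borel measurability *)

Section borel_sets.
Context d (R : realType) (X : measurableMetricType d R).
Hypothesis borelX : borel_sigma_algebra X.

Lemma measurable_open (U : set X) : open U -> measurable U.
Proof. by move=> oU; rewrite borelX; exact: sub_sigma_algebra. Qed.

Lemma measurable_mball (x : X) (r : R) : measurable (ball x r).
Proof.
by apply: measurable_open; exact: open_mball.
Qed.

Lemma measurable_fun_lsc (f : X -> R) : (forall a, open [set x | a < f x]) ->
  measurable_fun setT f.
Proof.
move=> of_ mD; apply: (measurability _ (RGenOInfty.measurableE R)) => //.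
move=> _ [_ [a ->] <-]; rewrite setTI; apply: measurable_open.
rewrite (_ : _ @^-1` _ = [set x | a < f x]) //.
by apply/seteqP; split => x /=; rewrite in_itv/= andbT.
Qed.

Lemma measurable_dist (E : set X) : E !=set0 ->
  measurable_fun setT (fun x => dist x E).
Proof.
move=> E0 mD; apply: (measurability _ (RGenInftyO.measurableE R)) => //.
move=> _ [_ [a ->] <-]; rewrite setTI; apply: measurable_open.
rewrite (_ : _ @^-1` _ = [set x | dist x E < a]); first exact: open_dist_lt.
by apply/seteqP; split => x /=; rewrite in_itv.
Qed.

Lemma measurable_dist_powR (E : set X) a : E !=set0 ->
  measurable_fun setT (fun x => dist x E `^ a).
Proof.
by move=> E0; apply: (measurableT_comp (measurable_powR _)); exact: measurable_dist.
Qed.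

Lemma measurable_dist_pow (E : set X) a : E !=set0 ->
  measurable_fun setT (dist_pow E a).
Proof.
move=> E0; rewrite /dist_pow; have [a0|a0] := ltP a 0; last first.
  under eq_fun do rewrite andbF.
  by apply/measurable_EFinP; exact: measurable_dist_powR.
under eq_fun do rewrite andbT.
apply: measurable_fun_ifT => //; last first.
  by apply/measurable_EFinP; exact: measurable_dist_powR.
by apply: measurable_fun_eqr => //; exact: measurable_dist.
Qed.

End borel_sets.

(** * Balls and nets in doubling spaces *)

Section volume_of_balls.
Context d (R : realType) (X : measurableMetricType d R).
Variable mu : {measure set X -> \bar R}.
Hypothesis borelX : borel_sigma_algebra X.
Hypothesis mu_ball : ball_measure_pos_fin mu.

Definition vol (x : X) (r : R) : R := fine (mu (ball x r)).

Lemma volE x r : 0 < r -> mu (ball x r) = (vol x r)%:E.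
Proof.
move=> r0; have /andP[p f] := mu_ball x r0.
by rewrite /vol fineK// ge0_fin_numE // ltW.
Qed.

Lemma vol_gt0 x r : 0 < r -> 0 < vol x r.
Proof. by move=> r0; rewrite -lte_fin -volE//; have /andP[] := mu_ball x r0. Qed.

Lemma le_vol x y r r' : 0 < r -> 0 < r' -> ball x r `<=` ball y r' ->
  vol x r <= vol y r'.
Proof.
move=> r0 r'0 s; rewrite -lee_fin -!volE //.
by apply: le_measure => //; rewrite inE; exact: measurable_mball.
Qed.

(** The balls of half the separation are disjoint. *)
Lemma sum_measure_separated (r : R) (s : seq X) (A : set X) : measurable A ->
  pairwise (fun x y => r <= mdist x y) s ->
  (forall z, z \in s -> ball z (r / 2) `<=` A) ->
  (\sum_(z <- s) mu (ball z (r / 2)) <= mu A)%E.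
Proof.
elim: s A => [|z s IH] A mA; first by rewrite big_nil.
rewrite pairwise_cons => /andP[zs ps] sA; rewrite big_cons.
have mz := measurable_mball borelX z (r / 2).
rewrite (measureDI mu mA mz) addeC leeD //.
  apply: IH => //; first exact: measurableD.
  move=> y ys; have yA : ball y (r / 2) `<=` A by apply: sA; rewrite inE ys orbT.
  move=> w yw; split; first exact: yA.
  move: yw => /in_ball yw /in_ball zw; move/allP: zs => /(_ _ ys) /= zy.
  by have := metric_triangle z w y; rewrite (metric_sym w y); lra.
apply: le_measure; rewrite ?inE //; first exact: measurableI.
by move=> w zw; split => //; apply: (sA z) => //; rewrite mem_head.
Qed.

Section doubling_constant.
Variable CD : R.
Hypothesis doublingCD : forall x r, 0 < r -> vol x (2 * r) <= CD * vol x r.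

Lemma CD_ge1 : 1 <= CD.
Proof.
have v0 := vol_gt0 (point : X) (@ltr01 R).
rewrite -(ler_pM2r v0) mul1r (le_trans _ (doublingCD _ _)) //.
by apply: le_vol => //; apply: ball_sub; rewrite mdistxx; lra.
Qed.

Lemma vol_scale (n : nat) x r : 0 < r -> vol x (2 ^+ n * r) <= CD ^+ n * vol x r.
Proof.
move=> r0; have c := CD_ge1.
elim: n => [|n IH]; first by rewrite !expr0 !mul1r.
rewrite !exprS -!mulrA (le_trans (doublingCD _ _)) //.
  by rewrite mulr_gt0 // exprn_gt0.
by rewrite ler_pM2l //; lra.
Qed.

Lemma vol_compare (n : nat) x y r r' : 0 < r -> 0 < r' ->
  mdist x y + r <= 2 ^+ n * r' -> vol y r <= CD ^+ n * vol x r'.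
Proof.
move=> r0 r'0 h; apply: le_trans (vol_scale n x r'0).
by apply: le_vol => //; [rewrite mulr_gt0 // exprn_gt0 | exact: ball_sub].
Qed.

(** The disjoint balls of radius [r / 2] around the points all lie in one ball
    whose volume is at most [CD ^+ (j + 3)] times that of each of them. *)
Lemma size_separated (j : nat) (r : R) (s : seq X) y : 0 < r ->
  pairwise (fun x y => r <= mdist x y) s ->
  (forall z, z \in s -> mdist y z < 2 ^+ j * r) ->
  (size s)%:R <= CD ^+ (j + 3).
Proof.
move=> r0 ps sy; set W := vol y (2 ^+ (j.+1) * r).
have W0 : 0 < W by apply: vol_gt0; rewrite mulr_gt0 // exprn_gt0.
have r20 : 0 < r / 2 by lra.
have c0 : 0 < CD by have := CD_ge1; lra.
have j0 : 1 <= 2 ^+ j :> R by apply: exprn_ege1; lra.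
rewrite -(ler_pM2r W0); apply: (@le_trans _ _
    (CD ^+ (j + 3) * \sum_(z <- s) vol z (r / 2))).
  rewrite mulr_sumr -sum1_size natr_sum mulr_suml.
  rewrite big_seq [leRHS]big_seq; apply: ler_sum => z zs; rewrite mul1r.
  apply: vol_compare => //; first by rewrite mulr_gt0 // exprn_gt0.
  have := sy _ zs; rewrite metric_sym addn3 !exprS => h.
  by nra.
rewrite ler_pM2l ?exprn_gt0 // -lee_fin.
rewrite -sumEFin /W -volE ?mulr_gt0 ?exprn_gt0 //.
under eq_bigr do rewrite -volE //.
apply: sum_measure_separated => //; first exact: measurable_mball.
move=> z zs; apply: ball_sub; have := sy _ zs; rewrite exprS; nra.
Qed.

(** Adding uncovered points one by one keeps the family separated, so it has to
    stop by the bound on the size of a separated family. *)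
Lemma exists_net (x0 : X) (r R0 : R) : 0 < r -> exists s : seq X,
  pairwise (fun x y => r <= mdist x y) s /\
  forall y, mdist x0 y < R0 -> exists2 z, z \in s & mdist z y < r.
Proof.
move=> r0; have [j Rj] : exists j : nat, R0 <= 2 ^+ j * r.
  have [k] := ltr_add_invr (@ltr01 R).
  have := truncnS_gt (R0 / r); set n := (Num.truncn _).+1 => h _.
  exists n; rewrite -ler_pdivrMr // (le_trans (ltW h)) //.
  by rewrite -natrX ler_nat ltnW // ltn_expl.
have [n nC] : exists n : nat, CD ^+ (j + 3) < n%:R.
  by exists (Num.truncn (CD ^+ (j + 3))).+1; exact: truncnS_gt.
pose P s := pairwise (fun x y => r <= mdist x y) s /\
  forall z : X, z \in s -> mdist x0 z < R0.
suff H k : (exists s, P s /\ size s = k) \/ (exists s, P s /\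
    forall y, mdist x0 y < R0 -> exists2 z, z \in s & mdist z y < r).
  case: (H n) => [[s [[ps sR] sn]]|[s [[ps _] sc]]]; last by exists s.
  have := size_separated r0 ps (fun z zs => lt_le_trans (sR z zs) Rj).
  by rewrite sn leNgt nC.
elim: k => [|k [[s [[ps sR] sk]]|]]; [|  | by right].
  by left; exists [::]; split.
have [sc|] := pselect (forall y, mdist x0 y < R0 ->
    exists2 z, z \in s & mdist z y < r); first by right; exists s.
move=> /existsNP[y /not_implyP[yR ny]]; left; exists (y :: s).
split; last by rewrite /= sk.
split; last by move=> z; rewrite inE => /predU1P[->|/sR].
rewrite pairwise_cons ps andbT; apply/allP => z zs /=.
by rewrite leNgt; apply/negP => yz; apply: ny; exists z; rewrite // metric_sym.
Qed.

(** The centers of the balls that contain [y] are separated points near [y]. *)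
Lemma overlap_net (j : nat) (r : R) (s : seq X) y : 0 < r ->
  pairwise (fun x y => r <= mdist x y) s ->
  \sum_(z <- s) \1_(ball z (2 ^+ j * r)) y <= CD ^+ (j + 3).
Proof.
move=> r0 ps; pose s' := [seq z <- s | mdist y z < 2 ^+ j * r].
have ps' : pairwise (fun x y => r <= mdist x y) s' by exact: pairwise_filter.
have sy z : z \in s' -> mdist y z < 2 ^+ j * r by rewrite mem_filter => /andP[].
apply: le_trans (size_separated r0 ps' sy).
rewrite -sum1_size big_filter natr_sum [leRHS]big_mkcond /=.
apply: ler_sum => z _; rewrite indicE; case: ifP => yz.
  by rewrite ler_nat leq_b1.
by rewrite memNset // => /in_ball; rewrite metric_sym yz.
Qed.

End doubling_constant.
End volume_of_balls.

(** * Powers, geometric sums and the balancing of scales *)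

Section real_lemmas.
Context {R : realType}.
Implicit Types a b r s x y : R.

Lemma powR_expR x a : 0 < x -> x `^ a = expR (a * ln x).
Proof. by move=> x0; rewrite /powR gt_eqF. Qed.

Lemma powR_exprn x s i : 0 <= x -> (x `^ s) ^+ i = (x ^+ i) `^ s.
Proof.
move=> x0; rewrite -(powR_mulrn i (powR_ge0 x s)) -(powR_mulrn i x0).
exact: powRAC.
Qed.

Lemma powR_half r s i : 0 < r -> (r / 2 ^+ i) `^ s = r `^ s * (2 `^ (- s)) ^+ i.
Proof.
move=> r0; have e0 : 0 < 2 ^+ i :> R by rewrite exprn_gt0.
rewrite powRM ?invr_ge0 ?(ltW r0) ?(ltW e0) // powR_exprn //; congr (_ * _).
by rewrite -(powR_inv1 (ltW e0)) -powRrM mulN1r.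
Qed.

Lemma powR_twice r s i : 0 < r -> (2 ^+ i * r) `^ s = (2 `^ s) ^+ i * r `^ s.
Proof.
move=> r0; have e0 : 0 < 2 ^+ i :> R by rewrite exprn_gt0.
by rewrite powRM ?(ltW r0) ?(ltW e0) // powR_exprn.
Qed.

Lemma two_powR_gt1 s : 0 < s -> 1 < 2 `^ s :> R.
Proof.
move=> s0; rewrite powR_expR // -[ltLHS]expR0 ltr_expR mulr_gt0 //.
by apply: ln_gt0; lra.
Qed.

Lemma two_powRN_lt1 s : 0 < s -> 2 `^ (- s) < 1 :> R.
Proof.
by move=> s0; rewrite powRN invf_lt1 ?two_powR_gt1 // powR_gt0.
Qed.

Lemma geometric_le b n : 0 <= b -> b < 1 -> \sum_(i < n) b ^+ i <= (1 - b)^-1.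
Proof.
move=> b0 b1; elim: n => [|n IH]; first by rewrite big_ord0 invr_ge0; lra.
rewrite big_ord_recl expr0.
under eq_bigr do rewrite /bump /= exprS.
rewrite -mulr_sumr (_ : (1 - b)^-1 = 1 + b * (1 - b)^-1); last first.
  by field; lra.
by rewrite lerD2l ler_wpM2l.
Qed.

Lemma geometric_growth_le b n : 1 < b ->
  \sum_(i < n) b ^+ i.+1 <= b / (b - 1) * b ^+ n.
Proof.
move=> b1; have bn k : 0 < b ^+ k by apply: exprn_gt0; lra.
elim: n => [|n IH].
  by rewrite big_ord0 expr0 mulr1 divr_ge0; lra.
rewrite big_ord_recr /=.
rewrite (_ : b / (b - 1) * b ^+ n.+1 = b / (b - 1) * b ^+ n + b ^+ n.+1).
  by rewrite lerD2r.
by rewrite exprS; field; lra.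
Qed.

Lemma dyadic_floor a b : 0 < a -> a <= b ->
  exists n : nat, 2 ^+ n * a <= b /\ b < 2 ^+ n.+1 * a.
Proof.
move=> a0 ab.
have [N bN] : exists N : nat, b < 2 ^+ N * a.
  exists (Num.truncn (b / a)).+1; rewrite -ltr_pdivrMr //.
  by rewrite (lt_trans (truncnS_gt _)) // -natrX ltr_nat ltn_expl.
elim: N bN => [|N IH] bN; first by move: bN; rewrite expr0 mul1r; lra.
by have [/IH//|h] := ltP b (2 ^+ N * a); exists N.
Qed.

(** Otherwise the steps, being geometrically small, could not take the sequence
    from near [F] down to [0]. *)
Lemma large_step (z : R) : 0 < z -> exists K : R, 0 < K /\
  forall (F : R) (A : nat -> R),
    (forall e, 0 < e -> exists n, `|A n| <= e) ->
    `|F| <= 4 * `|F - A 0%N| \/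
    exists i, `|F| <= K * (2 `^ z) ^+ i * `|A i - A i.+1|.
Proof.
move=> z0; set b := 2 `^ (- z) : R.
have b1 : b < 1 by exact: two_powRN_lt1.
have b0 : 0 < b by exact: powR_gt0.
exists (4 / (1 - b)); split=> [|F A A0]; first by rewrite divr_gt0 //; lra.
have [/normr0P/eqP->|F0] := eqVneq `|F| 0.
  by left; rewrite normr0 mulr_ge0.
have {}F0 : 0 < `|F| by rewrite lt_def F0 normr_ge0.
have [h|h] := leP `|F| (4 * `|F - A 0%N|); first by left.
right; apply: contrapT => /forallNP nstep.
have step i : `|A i - A i.+1| <= (1 - b) / 4 * `|F| * b ^+ i.
  have /negP := nstep i; rewrite -ltNge => /ltW.
  rewrite -/b (_ : 2 `^ z = b^-1); last by rewrite /b powRN invrK.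
  have bi : 0 < b ^+ i by exact: exprn_gt0.
  rewrite exprVn (_ : 4 / (1 - b) / b ^+ i * `|A i - A i.+1| =
    `|A i - A i.+1| / ((1 - b) / 4 * b ^+ i)); last by field; lra.
  by rewrite ler_pdivrMr ?mulr_gt0 //; first lra; nra.
have near n : `|F - A n| <= `|F| / 4 + (1 - b) / 4 * `|F| * \sum_(i < n) b ^+ i.
  elim: n => [|n IH]; first by rewrite big_ord0 mulr0 addr0; lra.
  rewrite big_ord_recr /= mulrDr addrA.
  rewrite (_ : F - A n.+1 = (F - A n) + (A n - A n.+1)); last by ring.
  by apply: le_trans (ler_normD _ _) _; exact: lerD.
have [n An] : exists n, `|A n| <= `|F| / 4 by apply: A0; lra.
have := near n; have := geometric_le n (ltW b0) b1.
set S := \sum_(i < n) _ => Sb nn.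
have FS : (1 - b) / 4 * `|F| * S <= `|F| / 4.
  rewrite (_ : `|F| / 4 = (1 - b) / 4 * `|F| * (1 - b)^-1); last by field; lra.
  by rewrite ler_wpM2l // mulr_ge0 //; lra.
have := ler_distD (A n) F 0; rewrite !subr0; lra.
Qed.

(** Hedberg's optimization.  The first term of the bound on [L] grows with the
    radius and the second one decays; balancing them gives the critical
    Sobolev exponent. *)
Lemma hedberg_balance (s Q p q beta K : R) : 0 < s -> 1 < p -> p <= q ->
  s * p < Q -> q <= Q * p / (Q - s * p) -> 0 < K ->
  exists C : R, 0 < C /\ forall (L h J D r : R),
    0 <= L -> 0 <= h -> 0 < J -> 0 < r -> 8 * r <= D -> D <= 16 * r ->
    L <= K * (r `^ s * h) ->
    (forall N : nat, L <= K * ((r / 2 ^+ N) `^ s * h +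
       (r / 2 ^+ N) `^ (s - Q / p) * (D `^ (- beta / p) * J `^ p^-1))) ->
    L `^ q * D `^ (q / p * (Q - s * p + beta) - Q) <=
      C * (h `^ p * D `^ beta * J `^ (q / p - 1)).
Proof.
move=> s0 p1 pq spQ qle K0.
have p0 : 0 < p by lra.
have q0 : 0 < q by lra.
have Q0 : 0 < Q by have := mulr_gt0 s0 p0; lra.
(* The sign of this exponent is the Sobolev restriction on [q]; it is zero at
the critical exponent. *)
have kap : 0 <= p - q + s * p * q / Q.
  rewrite (_ : p - q + _ = (Q * p - q * (Q - s * p)) / Q); last by field; lra.
  by rewrite divr_ge0 ?(ltW Q0) // subr_ge0 -ler_pdivlMr // subr_gt0.
pose K' := K * (1 + 16 `^ (Q / p - s)).
have K'0 : 0 < K' by rewrite mulr_gt0 // addr_gt0 // powR_gt0.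
have K'K : K <= K'.
  by rewrite ler_peMr ?(ltW K0) // lerDl powR_ge0.
exists (K' `^ q); split=> [|L h J D r L0 h0 J0 r0 rD Dr Lh LN].
  exact: powR_gt0.
have D0 : 0 < D by lra.
move: L0; rewrite le_eqVlt => /predU1P[<-|L0].
  rewrite powR0 ?gt_eqF // mul0r.
  by rewrite !mulr_ge0 // powR_ge0.
move: h0; rewrite le_eqVlt => /predU1P[h0|h0].
  by move: Lh; rewrite -h0 !mulr0; lra.
pose lL := ln L; pose lh := ln h; pose lJ := ln J; pose lD := ln D.
pose lK := ln K'.
suff : q * lL + (q / p * (Q - s * p + beta) - Q) * lD <=
    q * lK + (p * lh + beta * lD + (q / p - 1) * lJ).
  by rewrite !powR_expR // -!expRD ler_expR.
have DK : L <= K * (D `^ s * h).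
  apply: le_trans Lh _; rewrite ler_pM2l // ler_pM2r //.
  by rewrite ge0_ler_powR ?nnegrE //; lra.
(* The balancing radius is [expR lr] with [lr] as below.  In the first case it is
at least [D], and no smaller radius than [r] is of use. *)
have [small|large] := leP (lh + Q / p * lD) (- beta / p * lD + lJ / p).
  have : lL <= lK + s * lD + lh.
    rewrite -ler_expR !expRD /lL /lK /lh !lnK ?posrE // -powR_expR //.
    by rewrite -mulrA (le_trans DK) // ler_wpM2r // mulr_ge0 ?powR_ge0 // ltW.
  move=> /(ler_wpM2l (ltW q0)) h1.
  have h2 : 0 <= (q - p) * (- beta / p * lD + lJ / p - (lh + Q / p * lD)).
    by rewrite mulr_ge0; lra.
  rewrite -subr_ge0; apply: le_trans h2 _.
  rewrite -subr_ge0; move: h1; rewrite -subr_ge0 => h1.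
  apply: le_trans h1 _; rewrite le_eqVlt; apply/orP; left; apply/eqP.
  by field; lra.
pose lr := p / Q * (- beta / p * lD + lJ / p - lh).
have lrD : lr <= lD.
  rewrite /lr mulrC -ler_pdivlMr ?divr_gt0 // invf_div; lra.
pose t := expR lr.
have tD : t <= D by rewrite -[leRHS]lnK ?posrE // ler_expR.
have t0 : 0 < t by exact: expR_gt0.
have [N [Nt tN]] : exists N, r / 2 ^+ N <= t /\ t <= 16 * (r / 2 ^+ N).
  have [rt|tr] := leP r t.
    by exists 0%N; rewrite expr0 divr1; split => //; lra.
  have [n [n1 n2]] := dyadic_floor t0 (ltW tr).
  have e0 : 0 < 2 ^+ n :> R by exact: exprn_gt0.
  exists n.+1; split.
    by rewrite ler_pdivrMr ?exprn_gt0 // mulrC ltW.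
  rewrite exprS mulrA ler_pdivlMr ?mulr_gt0 //; nra.
have LN' : L <= K' * (t `^ s * h).
  apply: le_trans (LN N) _.
  have rN : 0 < r / 2 ^+ N by rewrite divr_gt0 // exprn_gt0.
  rewrite /K' -mulrA ler_pM2l // mulrDl mul1r lerD //.
    by rewrite ler_pM2r // ge0_ler_powR ?nnegrE //; lra.
  have -> : t `^ s * h = t `^ (s - Q / p) * (D `^ (- beta / p) * J `^ p^-1).
    rewrite !powR_expR // -[h]lnK ?posrE // -!expRD /t expRK; congr expR.
    rewrite /lr -/lD -/lJ -/lh; field; lra.
  rewrite [leRHS]mulrA ler_pM2r ?mulr_gt0 ?powR_gt0 //.
  rewrite (_ : s - Q / p = - (Q / p - s)); last by ring.
  have e0 : 0 <= Q / p - s.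
    by rewrite subr_ge0 ler_pdivlMr // ltW.
  rewrite !powRN ler_pdivlMr ?powR_gt0 // mulrC ler_pdivrMr ?powR_gt0 //.
  rewrite -powRM ?(ltW rN) //.
  by rewrite ge0_ler_powR ?nnegrE //; lra.
have : lL <= lK + s * lr + lh.
  rewrite -ler_expR !expRD /lL /lK /lh !lnK ?posrE //.
  rewrite -mulrA; move: LN'; rewrite powR_expR // /t expRK //.
move=> /(ler_wpM2l (ltW q0)) h1.
have h2 : 0 <= (p - q + s * p * q / Q) * (Q / p) * (lD - lr).
  by rewrite !mulr_ge0 ?subr_ge0 ?invr_ge0 // ltW.
rewrite -subr_ge0; apply: le_trans h2 _.
rewrite -subr_ge0; move: h1; rewrite -subr_ge0 => h1.
apply: le_trans h1 _; rewrite le_eqVlt; apply/orP; left; apply/eqP.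
by rewrite /lr; field; lra.
Qed.

End real_lemmas.

(** * Powers of the distance under a codimension bound *)

Section nonnegative_series.
Context {R : realType}.
Implicit Type u : nat -> \bar R.
Local Open Scope ereal_scope.

Lemma nneseries_ge_term u n : (forall k, 0 <= u k) ->
  u n <= \sum_(k <oo) u k.
Proof.
move=> u0; apply: le_trans (@nneseries_lim_ge _ u predT 0%N n.+1 _); last by [].
by rewrite big_nat_recr //= leeDr // sume_ge0.
Qed.

Lemma nneseries_le u M : (forall k, 0 <= u k) ->
  (forall n, \sum_(k < n) u k <= M) -> \sum_(k <oo) u k <= M.
Proof.
move=> u0 uM; apply: lime_le; first exact: is_cvg_nneseries.
by apply: nearW => n; rewrite big_mkord.
Qed.

End nonnegative_series.

Section distance_weights.
Context d (R : realType) (X : measurableMetricType d R).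
Variable mu : {measure set X -> \bar R}.
Hypothesis borelX : borel_sigma_algebra X.
Hypothesis mu_ball : ball_measure_pos_fin mu.
Variable CD : R.
Hypothesis doublingCD : forall x r, 0 < r -> vol mu x (2 * r) <= CD * vol mu x r.
Variables (E : set X) (CE rho : R).
Hypothesis E0 : E !=set0.
Hypothesis CE1 : 1 <= CE.
Hypothesis rho0 : 0 <= rho.
Hypothesis codimE : forall e r r', E e -> 0 < r -> r < r' ->
  (mu (neighborhood E r `&` ball e r') <=
   (CE * (r / r') `^ rho * vol mu e r')%:E)%E.

Local Notation vol := (vol mu).

Lemma dist_pow_ge0 a x : (0 <= dist_pow E a x)%E.
Proof. by rewrite /dist_pow; case: ifP => // _; rewrite lee_fin powR_ge0. Qed.

Lemma measurable_neighborhood r : measurable (neighborhood E r).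
Proof. by apply: measurable_open => //; exact: open_dist_lt. Qed.

(** The term with [18 * r / 2 ^ j] within a factor [2] of the distance of [x]
    suffices.  On [E] every term counts and the series diverges, as it should. *)
Lemma dist_pow_layers gam x r : 0 < gam -> 0 < r -> dist x E < 18 * r ->
  (dist_pow E (- gam) x <= \sum_(j <oo)
     ((9 * r) `^ (- gam) * (2 `^ gam) ^+ j *
      \1_(neighborhood E (36 * r / 2 ^+ j)) x)%:E)%E.
Proof.
move=> g0 r0 xr; set u := (X in (_ <= X)%E).
have c0 : 0 < (9 * r) `^ (- gam) by rewrite powR_gt0 // mulr_gt0.
have b1 : 1 < 2 `^ gam :> R by exact: two_powR_gt1.
have t0 j : (0 <= ((9 * r) `^ (- gam) * (2 `^ gam) ^+ j *
      \1_(neighborhood E (36 * r / 2 ^+ j)) x)%:E)%E.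
  by rewrite lee_fin !mulr_ge0 ?exprn_ge0 ?powR_ge0 // indicE ler0n.
have e0 j : 0 < 2 ^+ j :> R by exact: exprn_gt0.
have [x0|x0] := eqVneq (dist x E) 0.
  suff -> : u = +oo%E by rewrite leey.
  apply: eq_infty => M.
  pose n := (Num.truncn (M / (9 * r) `^ (- gam))).+1.
  apply: (@le_trans _ _ ((9 * r) `^ (- gam) *+ n)%:E).
    rewrite lee_fin -mulr_natr mulrC -ler_pdivrMr //.
    by rewrite ltW // truncnS_gt.
  apply: le_trans (@nneseries_lim_ge _ _ predT 0%N n _); last by move=> *; exact: t0.
  rewrite big_mkord sumEFin lee_fin -[n in leLHS](card_ord n) -sumr_const.
  apply: ler_sum => j _; rewrite indicE mem_set ?mulr1; last first.
    by rewrite /neighborhood /= x0 divr_gt0 // mulr_gt0.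
  by rewrite ler_peMr ?(ltW c0) // exprn_ege1 // ltW.
have {}x0 : 0 < dist x E by rewrite lt_def x0; exact: dist_ge0.
have [n [n1 n2]] := dyadic_floor x0 (ltW xr).
apply: le_trans (nneseries_ge_term n t0).
rewrite /dist_pow (gt_eqF x0) /= lee_fin indicE mem_set ?mulr1; last first.
  rewrite /neighborhood /= ltr_pdivlMr // mulrC; lra.
rewrite -[X in 2 `^ X]opprK -powR_half ?mulr_gt0 //.
rewrite !powRN lef_pV2 ?posrE ?powR_gt0 ?divr_gt0 ?mulr_gt0 //.
apply: ge0_ler_powR; rewrite ?nnegrE ?divr_ge0 ?mulr_ge0 ?ltW //.
rewrite ltr_pdivrMr // mulrC; move: n2; rewrite exprS; lra.
Qed.

(** The codimension bound is about balls centered on [E]; a ball near [E] is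
    contained in one of comparable volume. *)
Lemma measure_neighborhood_ball x r k : 0 < r -> 0 < k -> k <= 36 ->
  dist x E < 17 * r ->
  (mu (neighborhood E (k * r) `&` ball x r) <=
     (CE * (k / 72) `^ rho * (CD ^+ 7 * vol x r))%:E)%E.
Proof.
move=> r0 k0 k36 xr; have CE_1 := CE1; have [e Ee xe] := dist_lt_ex E0 xr.
apply: (@le_trans _ _ (mu (neighborhood E (k * r) `&` ball e (72 * r)))).
  have m2 (x' : X) r' : measurable (neighborhood E (k * r) `&` ball x' r').
    apply: measurableI; first exact: measurable_neighborhood.
    exact: measurable_mball.
  apply: le_measure; rewrite ?inE //.
  by apply: setIS; apply: ball_sub; rewrite metric_sym; lra.
apply: le_trans (@codimE e (k * r) (72 * r) Ee _ _) _; rewrite ?mulr_gt0 //; first nra.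
rewrite -mulf_div divff ?gt_eqF // mulr1 lee_fin ler_wpM2l //.
  by rewrite mulr_ge0 ?powR_ge0 //; lra.
apply: vol_compare => //; first by rewrite mulr_gt0.
by rewrite !exprS expr0; lra.
Qed.

(** Aikawa's condition: the codimension makes negative powers of the distance
    as integrable near [E] as if [E] were not there. *)
Lemma integral_dist_powN_le gam : gam < rho -> exists C : R, 0 < C /\
  forall x r, 0 < r -> dist x E < 17 * r ->
  (\int[mu]_(y in ball x r) dist_pow E (- gam) y <=
     (C * r `^ (- gam) * vol x r)%:E)%E.
Proof.
move=> gr; have CD1 := CD_ge1 borelX mu_ball doublingCD; have CE_1 := CE1.
have near x r y : dist x E < 17 * r -> ball x r y -> dist y E < 18 * r.
  move=> xr /in_ball xy.
  by have := dist_triangle y x E0; rewrite (metric_sym y x); lra.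
have [g0|g0] := ltP 0 gam; last first.
  exists (18 `^ (- gam)); split=> [|x r r0 xr]; first exact: powR_gt0.
  have -> : (18 `^ (- gam) * r `^ (- gam) * vol x r)%:E =
      (\int[mu]_(y in ball x r) cst ((18 * r) `^ (- gam))%:E y)%E.
    rewrite integral_cst; last exact: measurable_mball.
    by rewrite volE // -EFinM -powRM // ltW.
  apply: ge0_le_integral.
  - exact: measurable_mball.
  - by move=> y _; exact: dist_pow_ge0.
  - by apply: measurable_funTS; exact: measurable_dist_pow.
  - exact: measurable_cst.
  move=> y xy; rewrite /dist_pow ltrNl oppr0 ltNge g0 andbF lee_fin.
  rewrite ge0_ler_powR ?nnegrE ?dist_ge0 ?oppr_ge0 ?mulr_ge0 ?(ltW r0) //.
  by rewrite ltW // (near x).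
pose b := 2 `^ (- (rho - gam)) : R.
have b1 : b < 1 by apply: two_powRN_lt1; lra.
have b0 : 0 < b by exact: powR_gt0.
exists (9 `^ (- gam) * CE * CD ^+ 7 * (1 - b)^-1); split=> [|x r r0 xr].
  by rewrite !mulr_gt0 ?powR_gt0 ?exprn_gt0 ?invr_gt0 //; lra.
pose c j : R := (9 * r) `^ (- gam) * (2 `^ gam) ^+ j.
have c0 j : 0 <= c j by rewrite mulr_ge0 ?exprn_ge0 ?powR_ge0.
pose N j := neighborhood E (36 * r / 2 ^+ j).
have mN j : measurable (N j) by exact: measurable_neighborhood.
have mB := measurable_mball borelX x r.
have m1 j : measurable_fun (ball x r) (fun y => (\1_(N j) y)%:E : \bar R).
  by apply/measurable_EFinP; exact: measurable_indic.
have mc j : measurable_fun (ball x r) (fun y => (c j * \1_(N j) y)%:E).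
  apply/measurable_EFinP; apply: measurable_funM => //.
have p0 j y : (0 <= (c j * \1_(N j) y)%:E)%E.
  by rewrite lee_fin mulr_ge0 // indicE ler0n.
apply: (@le_trans _ _ (\int[mu]_(y in ball x r)
    \sum_(j <oo) (c j * \1_(N j) y)%:E)%E).
  apply: ge0_le_integral => //.
  - by move=> y _; exact: dist_pow_ge0.
  - by apply: measurable_funTS; exact: measurable_dist_pow.
  - by apply: ge0_emeasurable_sum => // k y _ _; exact: p0.
  by move=> y xy; apply: dist_pow_layers => //; exact: near xy.
rewrite integral_nneseries //.
apply: nneseries_le => [j|n]; first by apply: integral_ge0 => y _; exact: p0.
have term j : (\int[mu]_(y in ball x r) (c j * \1_(N j) y)%:E <=
    (9 `^ (- gam) * r `^ (- gam) * CE * (CD ^+ 7 * vol x r) * b ^+ j)%:E)%E.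
  under eq_integral do rewrite EFinM.
  rewrite ge0_integralZl_EFin //.
  rewrite integral_indic //.
  have e0 : 0 < 2 ^+ j :> R by exact: exprn_gt0.
  have e1 : 1 <= 2 ^+ j :> R by apply: exprn_ege1; lra.
  apply: (@le_trans _ _ ((c j)%:E *
      (CE * (36 / 2 ^+ j / 72) `^ rho * (CD ^+ 7 * vol x r))%:E)%E).
    apply: lee_wpmul2l; first by rewrite lee_fin.
    rewrite /N (_ : 36 * r / 2 ^+ j = 36 / 2 ^+ j * r); last by field; lra.
    apply: measure_neighborhood_ball => //.
    by rewrite ler_pdivrMr // ler_peMr.
  rewrite -EFinM lee_fin /c.
  have V0 : 0 < vol x r by exact: vol_gt0.
  have -> : b ^+ j = (2 `^ gam) ^+ j * (2 `^ (- rho)) ^+ j.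
    rewrite /b -exprMn -powRD; first by congr (_ `^ _ ^+ _); lra.
    by apply/implyP => _; rewrite pnatr_eq0.
  rewrite powRM ?(ltW r0) //.
  have -> : 36 / 2 ^+ j / 72 = 2^-1 / 2 ^+ j :> R by field; lra.
  rewrite powR_half ?invr_gt0 //.
  have h1 : 2^-1 `^ rho <= 1 :> R.
    rewrite -[leRHS](powRr0 (2^-1)); apply: ger_powR => //; lra.
  rewrite -subr_ge0.
  set a1 := 9 `^ _; set a2 := r `^ _; set a3 := (2 `^ gam) ^+ j.
  set a4 := _ ^+ j; set a5 := _ `^ rho.
  rewrite (_ : _ - _ = a1 * a2 * a3 * CE * a4 * (CD ^+ 7 * vol x r) * (1 - a5)).
    rewrite !mulr_ge0 ?powR_ge0 ?exprn_ge0 ?subr_ge0 ?powR_ge0 //; lra.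
  by ring.
apply: (@le_trans _ _ (\sum_(j < n)
    (9 `^ (- gam) * r `^ (- gam) * CE * (CD ^+ 7 * vol x r) * b ^+ j)%:E)%E).
  by apply: lee_sum => j _; exact: term.
rewrite sumEFin lee_fin -mulr_sumr.
have := geometric_le n (ltW b0) b1.
set S := \sum_(i < n) _ => Sb.
rewrite (_ : 9 `^ (- gam) * CE * CD ^+ 7 * (1 - b)^-1 * r `^ (- gam) * vol x r =
  9 `^ (- gam) * r `^ (- gam) * CE * (CD ^+ 7 * vol x r) * (1 - b)^-1); last by ring.
have V0 : 0 < vol x r by exact: vol_gt0.
by rewrite ler_wpM2l // !mulr_ge0 ?powR_ge0 ?exprn_ge0 ?(ltW V0) //; lra.
Qed.


(** An exponent larger than [beta] for which the weight is bounded near [E]. *)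
Definition theta (beta : R) : R := if beta < 0 then 0 else beta + 1.

Lemma theta_ge0 beta : 0 <= theta beta.
Proof. by rewrite /theta; case: ltP => // b0; lra. Qed.

Lemma lt_theta beta : beta < theta beta.
Proof. by rewrite /theta; case: (ltP beta 0) => // b0; lra. Qed.

Lemma measurable_theta beta :
  measurable_fun setT (fun y => (dist y E `^ theta beta)%:E).
Proof. by apply/measurable_EFinP; exact: measurable_dist_powR. Qed.

(** If [rho > 0], the points of a ball that are much closer to [E] than its
    radius fill at most half of it. *)
Lemma integral_theta_ge beta : (0 <= beta -> 0 < rho) -> exists c : R, 0 < c /\
  forall x r, 0 < r -> dist x E < 17 * r ->
  ((c * r `^ theta beta * vol x r)%:E <=
     \int[mu]_(y in ball x r) (dist y E `^ theta beta)%:E)%E.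
Proof.
move=> brho; have CE_1 := CE1; have CD1 := CD_ge1 borelX mu_ball doublingCD.
have mt r x : measurable_fun (ball x r) (fun y => (dist y E `^ theta beta)%:E).
  by apply: measurable_funTS; exact: measurable_theta.
have [b0|b0] := ltP beta 0.
  exists 1; split=> // x r r0 xr.
  under eq_integral do rewrite /theta b0 powRr0.
  rewrite integral_cst; last exact: measurable_mball.
  by rewrite mul1e /theta b0 powRr0 !mul1r volE.
have {brho}rho_gt0 := brho b0.
have Z1 : 1 <= 2 * CE * CD ^+ 7.
  have h : 1 <= CD ^+ 7 by exact: exprn_ege1.
  nra.
have Z0 : 0 < 2 * CE * CD ^+ 7 by lra.
pose k := (2 * CE * CD ^+ 7) `^ (- rho^-1).
have k0 : 0 < k by exact: powR_gt0.
have krho : k `^ rho = (2 * CE * CD ^+ 7)^-1.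
  by rewrite /k -powRrM mulNr mulVf ?gt_eqF // powR_inv1 // ltW.
have k1 : k <= 1.
  rewrite /k powRN invf_le1 ?powR_gt0 // -[leLHS](powRr0 (2 * CE * CD ^+ 7)).
  by apply: ler_powR => //; rewrite invr_ge0.
exists (k `^ theta beta / 2); split=> [|x r r0 xr].
  by rewrite divr_gt0 // powR_gt0.
have mB := measurable_mball borelX x r.
have mN : measurable (neighborhood E (k * r)) by exact: measurable_neighborhood.
have V0 : 0 < vol x r by exact: vol_gt0.
apply: (@le_trans _ _ (\int[mu]_(y in ball x r `\` neighborhood E (k * r))
    (dist y E `^ theta beta)%:E)%E); last first.
  apply: ge0_subset_integral => //; first exact: measurableD.
  by move=> y _; rewrite lee_fin powR_ge0.
have mBN : measurable (ball x r `\` neighborhood E (k * r)) by exact: measurableD.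
apply: (@le_trans _ _ (\int[mu]_(y in ball x r `\` neighborhood E (k * r))
    cst ((k * r) `^ theta beta)%:E y)%E); last first.
  apply: ge0_le_integral => //.
  - by move=> y _; rewrite lee_fin powR_ge0.
  - by apply: measurable_funTS; exact: measurable_theta.
  move=> y [_ /negP]; rewrite -leNgt => ky.
  rewrite lee_fin ge0_ler_powR ?nnegrE ?theta_ge0 ?dist_ge0 //.
  by rewrite mulr_ge0 ?ltW.
rewrite integral_cst // powRM ?(ltW k0) ?(ltW r0) //.
have half : ((vol x r / 2)%:E <= mu (ball x r `\` neighborhood E (k * r)))%E.
  have volD : (vol x r)%:E = (mu (ball x r `\` neighborhood E (k * r)) +
      mu (ball x r `&` neighborhood E (k * r)))%E.
    by rewrite -volE //; exact: measureDI.
  have small : (mu (ball x r `&` neighborhood E (k * r)) <= (vol x r / 2)%:E)%E.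
    rewrite setIC.
    apply: le_trans (measure_neighborhood_ball r0 k0 _ xr) _; first lra.
    rewrite lee_fin; have k72 : (k / 72) `^ rho <= (2 * CE * CD ^+ 7)^-1.
      by rewrite -krho ge0_ler_powR ?nnegrE //; lra.
    apply: (@le_trans _ _ (CE * (2 * CE * CD ^+ 7)^-1 * (CD ^+ 7 * vol x r))).
      apply: ler_wpM2r; first by rewrite mulr_ge0 ?exprn_ge0 ?(ltW V0) //; lra.
      by apply: ler_wpM2l => //; lra.
    rewrite le_eqVlt; apply/orP; left; apply/eqP; field.
    by rewrite !gt_eqF // ?exprn_gt0 //; lra.
  have : ((vol x r)%:E <= mu (ball x r `\` neighborhood E (k * r)) +
      (vol x r / 2)%:E)%E by rewrite volD leeD2l.
  by rewrite -leeBlDr // -EFinB {1}[vol x r]splitr addrK.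
apply: le_trans (lee_wpmul2l _ half); last by rewrite lee_fin mulr_ge0 ?powR_ge0.
by rewrite -EFinM lee_fin le_eqVlt; apply/orP; left; apply/eqP; field.
Qed.

(** Only the scales above [D / 18] contribute, and they do so geometrically. *)
Lemma scales_above_le (eta D eps : R) N : 0 < eta -> 0 < D -> 0 < eps ->
  \sum_(n < N) (2 ^+ n * eps) `^ (- eta) * (D < 18 * (2 ^+ n * eps))%R%:R <=
  18 `^ eta / (1 - 2 `^ (- eta)) * D `^ (- eta).
Proof.
move=> eta0 D0; have b1 := two_powRN_lt1 (R := R) eta0.
have b0 : 0 < 2 `^ (- eta) :> R by exact: powR_gt0.
elim: N eps => [|N IH] eps eps0.
  by rewrite big_ord0 mulr_ge0 ?divr_ge0 ?powR_ge0 //; lra.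
have [h|h] := ltP D (18 * eps); last first.
  rewrite big_ord_recl expr0 mul1r ltNge h mulr0 add0r.
  have e2 : 0 < 2 * eps by rewrite mulr_gt0.
  apply: le_trans (IH _ e2); apply: ler_sum => n _.
  have -> : 2 ^+ lift ord0 n * eps = 2 ^+ n * (2 * eps).
    by rewrite lift0 exprS; ring.
  exact: lexx.
apply: (@le_trans _ _ (\sum_(n < N.+1) eps `^ (- eta) * (2 `^ (- eta)) ^+ n)).
  apply: ler_sum => n _; rewrite powR_twice // [leRHS]mulrC.
  by rewrite ger_pMr ?mulr_gt0 ?exprn_gt0 ?powR_gt0 // lern1 leq_b1.
rewrite -mulr_sumr.
apply: (@le_trans _ _ (eps `^ (- eta) * (1 - 2 `^ (- eta))^-1)).
  by rewrite ler_wpM2l ?powR_ge0 // geometric_le // ltW.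
rewrite mulrAC ler_wpM2r ?invr_ge0 //; first lra.
rewrite !powRN ler_pdivlMr ?powR_gt0 // mulrC ler_pdivrMr ?powR_gt0 //.
by rewrite -powRM ?(ltW eps0) // ge0_ler_powR ?nnegrE //; lra.
Qed.

(** The inequality also holds on [E]: if [beta < 0] the right-hand side is
    infinite there, and otherwise [theta beta > 0] makes the left-hand side
    vanish. *)
Lemma scales_overlap beta : exists C : R, 0 < C /\ forall eps y, 0 < eps ->
  (\sum_(n <oo) ((2 ^+ n * eps) `^ (beta - theta beta) *
      (dist y E < 18 * (2 ^+ n * eps))%R%:R * dist y E `^ theta beta)%:E <=
   C%:E * dist_pow E beta y)%E.
Proof.
pose eta := theta beta - beta.
have eta0 : 0 < eta by rewrite subr_gt0; exact: lt_theta.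
have b1 := two_powRN_lt1 (R := R) eta0.
have C0 : 0 < 18 `^ eta / (1 - 2 `^ (- eta)) :> R.
  by rewrite divr_gt0 ?powR_gt0 //; lra.
exists (18 `^ eta / (1 - 2 `^ (- eta))); split=> // eps y eps0.
apply: nneseries_le => [n|N]; first by rewrite lee_fin !mulr_ge0 ?powR_ge0.
rewrite sumEFin -mulr_suml.
have [y0|y0] := eqVneq (dist y E) 0.
  rewrite /dist_pow y0 eqxx /=; case: ltP => b0.
    by rewrite gt0_muley ?lte_fin // leey.
  rewrite powR0 ?mulr0 -?EFinM ?lee_fin; first by rewrite mulr_ge0 ?powR_ge0 ?(ltW C0).
  by rewrite /theta ltNge b0 /= gt_eqF //; lra.
have {}y0 : 0 < dist y E by rewrite lt_def y0 dist_ge0.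
rewrite /dist_pow (gt_eqF y0) /= -EFinM lee_fin.
rewrite (_ : theta beta = eta + beta); last by rewrite /eta; ring.
rewrite powRD; last by apply/implyP => _; rewrite gt_eqF.
rewrite mulrA ler_wpM2r ?powR_ge0 //.
rewrite -ler_pdivlMr ?powR_gt0 // -powRN.
rewrite (_ : beta - (eta + beta) = - eta); last by ring.
exact: scales_above_le.
Qed.

Hypothesis E_closed : closed E.

Lemma measurable_closed_set : measurable E.
Proof.
by rewrite -[E]setCK; apply/measurableC/measurable_open => //; exact: closed_openC.
Qed.

Lemma dist_closed y : E y -> dist y E = 0.
Proof.
move=> Ey; apply/eqP; rewrite eq_le dist_ge0 andbT.
by rewrite -[leRHS](mdistxx y) dist_le.
Qed.

Lemma dist_gt0 y : ~ E y -> 0 < dist y E.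
Proof.
move=> nEy; rewrite lt_def dist_ge0 andbT; apply/eqP => y0; apply: nEy.
apply: E_closed => B /nbhs_ballP[e /= e0 eB].
have [z Ez yz] : exists2 z, E z & mdist y z < e by apply: dist_lt_ex; rewrite ?y0.
by exists z; split => //; apply: eB; apply/in_ball.
Qed.

(** In every ball, [E] lies in neighborhoods of [E] of arbitrarily small
    measure. *)
Lemma measure_codim_gt0 : 0 < rho -> mu E = 0%E.
Proof.
move=> rho_gt0; have [e Ee] := E0; have CE_1 := CE1.
have Eball n : mu (E `&` ball e n.+1%:R) = 0%E.
  have n0 : 0 < n.+1%:R :> R by [].
  apply/eqP; rewrite eq_le measure_ge0 andbT; apply/lee_addgt0Pr => z z0.
  rewrite add0e; have V0 := vol_gt0 mu_ball e n0.
  pose k := Num.min (2^-1) ((z / (CE * vol e n.+1%:R)) `^ rho^-1).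
  have k0 : 0 < k.
    rewrite lt_min invr_gt0 ltr0n /= powR_gt0 // divr_gt0 // mulr_gt0 //; lra.
  have k1 : k < 1 by rewrite gt_min invf_lt1 // ltr1n.
  apply: (@le_trans _ _ (mu (neighborhood E (k * n.+1%:R) `&` ball e n.+1%:R))).
    apply: le_measure; rewrite ?inE.
    - by apply: measurableI; [exact: measurable_closed_set | exact: measurable_mball].
    - by apply: measurableI; [exact: measurable_neighborhood | exact: measurable_mball].
    by apply: setSI => y Ey; rewrite /neighborhood /= dist_closed // mulr_gt0.
  apply: le_trans (codimE Ee _ _) _; rewrite ?mulr_gt0 ?gtr_pMl //.
  rewrite mulfK ?gt_eqF // lee_fin mulrAC mulrC -ler_pdivlMr ?mulr_gt0 //; last lra.
  have h0 : 0 <= z / (CE * vol e n.+1%:R).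
    by rewrite divr_ge0 ?mulr_ge0 ?(ltW z0) ?(ltW V0) //; lra.
  have -> : z / (CE * vol e n.+1%:R) =
      (z / (CE * vol e n.+1%:R)) `^ rho^-1 `^ rho.
    by rewrite -powRrM mulVf ?powRr1 // gt_eqF.
  by rewrite ge0_ler_powR ?nnegrE ?powR_ge0 ?(ltW k0) ?(ltW rho_gt0) // ge_min lexx orbT.
apply/eqP; rewrite eq_le measure_ge0 andbT.
apply: (@le_trans _ _ (\sum_(n <oo) mu (E `&` ball e n.+1%:R))%E).
  apply: measure_sigma_subadditive => //.
  - move=> n; apply: measurableI; first exact: measurable_closed_set.
    exact: measurable_mball.
  - exact: measurable_closed_set.
  move=> y Ey; exists (Num.truncn (mdist e y)) => //; split => //.
  by apply/in_ball; exact: truncnS_gt.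
by rewrite eseries0.
Qed.

(** Either the weight vanishes on [E] or [E] is a null set. *)
Lemma integral_on_closed_set (g : X -> \bar R) a : 0 < a \/ 0 < rho ->
  measurable_fun setT g -> (forall x, 0 <= g x)%E ->
  (\int[mu]_(x in E) (g x * dist_pow E a x) = 0)%E.
Proof.
move=> [a0|r0] mg g0.
  apply: integral0_eq => x Ex; rewrite /dist_pow ltNge (ltW a0) andbF.
  by rewrite dist_closed // powR0 ?mule0 // gt_eqF.
apply: null_set_integral; [exact: measurable_closed_set| |exact: measure_codim_gt0].
by apply: measurable_funTS; apply: emeasurable_funM => //; exact: measurable_dist_pow.
Qed.

End distance_weights.

(** * The local estimate *)

(** [A x r] stands for an average of [f] over [ball x r], and [h] for a
    fractional gradient of order [s]: the averages over concentric balls differ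
    by at most [r `^ s] times every value of [h] in the smaller ball. *)
Definition fractional_gradient (R : realType) d (X : measurableMetricType d R)
    (s : R) (f : X -> R) (A : X -> R -> R) (h : X -> R) : Prop :=
  [/\ (forall y, 0 <= h y), measurable_fun setT h,
      (forall x y r, 0 < r -> mdist x y < r ->
         `|A x r - A x (2 * r)| <= r `^ s * h y) &
      (forall x e, 0 < e -> exists2 r0, 0 < r0 &
         forall r, 0 < r -> r <= r0 -> `|f x - A x r| <= e)].

Section local_estimate.
Context d (R : realType) (X : measurableMetricType d R).
Variable mu : {measure set X -> \bar R}.
Hypothesis borelX : borel_sigma_algebra X.
Hypothesis mu_ball : ball_measure_pos_fin mu.
Variables (c Q : R).
Hypothesis c_gt0 : 0 < c.
Hypothesis vol_lower : forall x r, 0 < r -> c * r `^ Q <= vol mu x r.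
Variable E : set X.
Hypothesis E0 : E !=set0.
Variables (s p q beta : R).
Hypothesis s_gt0 : 0 < s.
Hypothesis p_gt1 : 1 < p.
Hypothesis p_leq : p <= q.
Hypothesis sp_ltQ : s * p < Q.
Hypothesis q_le : q <= Q * p / (Q - s * p).
Local Notation vol := (vol mu).
Implicit Types (f h : X -> R) (A : X -> R -> R) (x y : X).

Lemma measurable_powR_EFin (h : X -> R) a : measurable_fun setT h ->
  measurable_fun setT (fun y => (h y `^ a)%:E : \bar R).
Proof.
by move=> mh; apply/measurable_EFinP; apply: (measurableT_comp (measurable_powR _)).
Qed.

(** Telescoping towards radius [0], along balls all of which contain [x]. *)
Lemma approximation_le f A h x r : fractional_gradient s f A h -> 0 < r ->
  `|f x - A x r| <= (1 - 2 `^ (- s))^-1 * (r `^ s * h x).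
Proof.
move=> [h0 _ H1 H2] r0; set b := 2 `^ (- s).
have b1 : b < 1 by exact: two_powRN_lt1.
have b0 : 0 < b by exact: powR_gt0.
have tel n : `|A x (r / 2 ^+ n) - A x r| <= r `^ s * h x * \sum_(i < n) b ^+ i.
  elim: n => [|n IH].
    by rewrite expr0 divr1 subrr normr0 big_ord0 mulr0.
  rewrite big_ord_recr /= mulrDr (le_trans (ler_distD (A x (r / 2 ^+ n)) _ _)) //.
  rewrite addrC lerD //.
  have e0 : 0 < 2 ^+ n.+1 :> R by exact: exprn_gt0.
  have := H1 x x (r / 2 ^+ n.+1); rewrite mdistxx divr_gt0 // => /(_ isT isT).
  rewrite (_ : 2 * (r / 2 ^+ n.+1) = r / 2 ^+ n); last first.
    by rewrite exprS; field; rewrite expf_eq0 pnatr_eq0 andbF.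
  move=> /le_trans; apply; rewrite powR_half // -/b mulrAC ler_wpM2l //.
    by rewrite mulr_ge0 ?powR_ge0.
  by rewrite exprS ger_pMl ?exprn_gt0 // ltW.
apply/ler_addgt0Pl => e e0; have [r1 r10 fA] := H2 x e e0.
have [n rn] : exists n : nat, r / 2 ^+ n <= r1.
  exists (Num.truncn (r / r1)).+1; rewrite ler_pdivrMr ?exprn_gt0 // mulrC.
  rewrite -ler_pdivrMr // ltW // (lt_trans (truncnS_gt _)) // -natrX ltr_nat.
  exact: ltn_expl.
apply: le_trans (ler_distD (A x (r / 2 ^+ n)) _ _) _; apply: lerD.
  by apply: fA => //; rewrite divr_gt0 // exprn_gt0.
apply: le_trans (tel n) _; rewrite mulrC ler_wpM2r //.
  by rewrite mulr_ge0 ?powR_ge0.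
by apply: geometric_le => //; exact: ltW.
Qed.

(** The step of the averages is bounded by [r `^ s * h] on the whole ball, hence
    by any weighted mean of it. *)
Lemma step_mean_le f A h (w : X -> \bar R) x r : fractional_gradient s f A h ->
  0 < r -> measurable_fun setT w -> (forall y, 0 <= w y)%E ->
  ((`|A x r - A x (2 * r)| `^ p)%:E * \int[mu]_(y in ball x r) w y <=
   (r `^ (s * p))%:E * \int[mu]_(y in ball x r) ((h y `^ p)%:E * w y))%E.
Proof.
move=> [h0 mh H1 _] r0 mw w0; have p1 := p_gt1.
have mB := measurable_mball borelX x r.
have mwB : measurable_fun (ball x r) w by exact: measurable_funTS.
have mhw : measurable_fun (ball x r) (fun y => (h y `^ p)%:E * w y)%E.
  apply: emeasurable_funM => //.
  by apply: measurable_funTS; exact: measurable_powR_EFin.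
have hw0 y : (0 <= (h y `^ p)%:E * w y)%E by rewrite mule_ge0 // lee_fin powR_ge0.
rewrite -!ge0_integralZl_EFin ?powR_ge0 //.
apply: ge0_le_integral => //.
- by move=> y _; rewrite mule_ge0 // lee_fin powR_ge0.
- by apply: measurable_funeM.
- by apply: measurable_funeM.
move=> y /in_ball xy; rewrite muleA lee_wpmul2r // -EFinM lee_fin.
rewrite powRrM -powRM ?powR_ge0 //.
by rewrite ge0_ler_powR ?nnegrE ?mulr_ge0 ?powR_ge0 //; [lra | exact: H1].
Qed.

Lemma powR_comparable (a b t : R) : 0 < b -> b / 2 <= a -> a <= 2 * b ->
  2 `^ (- `|t|) * b `^ t <= a `^ t.
Proof.
move=> b0 ba ab; have a0 : 0 < a by lra.
have [t0|t0] := leP 0 t.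
  rewrite ger0_norm // powRN ler_pdivrMl ?powR_gt0 // -powRM ?(ltW a0) //.
  by rewrite ge0_ler_powR ?nnegrE //; lra.
rewrite ltr0_norm // opprK -powRM ?(ltW b0) // -[t]opprK !(powRN _ (- t)).
rewrite lef_pV2 ?posrE ?powR_gt0 ?mulr_gt0 //.
by rewrite ge0_ler_powR ?nnegrE //; lra.
Qed.

(** The weight is essentially constant on the ball, so the step is at most the
    mean of the energy, and the volume is bounded from below. *)
Lemma whitney_step_le : exists K : R, 0 < K /\
  forall f A h J x r, fractional_gradient s f A h -> 0 < J ->
  (\int[mu]_(y in [set: X]) ((h y `^ p)%:E * dist_pow E beta y) <= J%:E)%E ->
  0 < r -> 2 * r <= dist x E ->
  `|A x r - A x (2 * r)| <=
    K * (r `^ (s - Q / p) * (dist x E `^ (- beta / p) * J `^ p^-1)).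
Proof.
have c0 := c_gt0; have p1 := p_gt1; have p0 : 0 < p by lra.
exists ((2 `^ `|beta| / c) `^ p^-1); split.
  by rewrite powR_gt0 // divr_gt0 // powR_gt0.
move=> f A h J x r fAh J0 hJ r0 rD; have [h0 mh H1 _] := fAh.
set D := dist x E; set u := `|_ - _|.
have D0 : 0 < D by rewrite /D; lra.
have mw : measurable_fun setT (dist_pow E beta) by exact: measurable_dist_pow.
have w0 y : (0 <= dist_pow E beta y)%E by exact: dist_pow_ge0.
have mB := measurable_mball borelX x r.
have low : ((2 `^ (- `|beta|) * D `^ beta * vol x r)%:E <=
    \int[mu]_(y in ball x r) dist_pow E beta y)%E.
  have -> : (2 `^ (- `|beta|) * D `^ beta * vol x r)%:E =
      (\int[mu]_(y in ball x r) cst (2 `^ (- `|beta|) * D `^ beta)%:E y)%E.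
    by rewrite integral_cst // volE.
  apply: ge0_le_integral => //.
  - by move=> y _; rewrite lee_fin mulr_ge0 ?powR_ge0.
  - exact: measurable_funTS.
  move=> y /in_ball xy.
  have := dist_triangle x y E0; have := dist_triangle y x E0.
  rewrite (metric_sym y x) -/D => h1 h2.
  have y0 : 0 < dist y E by lra.
  rewrite /dist_pow (gt_eqF y0) /= lee_fin.
  by apply: powR_comparable => //; lra.
have upJ : u `^ p * (2 `^ (- `|beta|) * D `^ beta * vol x r) <= r `^ (s * p) * J.
  rewrite -lee_fin EFinM; apply: (@le_trans _ _ ((u `^ p)%:E *
      \int[mu]_(y in ball x r) dist_pow E beta y)%E).
    by apply: lee_wpmul2l => //; rewrite lee_fin powR_ge0.
  apply: le_trans (step_mean_le x fAh r0 mw w0) _; rewrite EFinM.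
  apply: lee_wpmul2l; first by rewrite lee_fin powR_ge0.
  apply: le_trans hJ; apply: ge0_subset_integral => //.
  - by apply: emeasurable_funM => //; exact: measurable_powR_EFin.
  - by move=> y _; rewrite mule_ge0 // lee_fin powR_ge0.
have {upJ} : u `^ p <=
    2 `^ `|beta| / c * (r `^ (s * p - Q) * (D `^ (- beta) * J)).
  have P0 : 0 < 2 `^ (- `|beta|) * D `^ beta * (c * r `^ Q).
    by rewrite !mulr_gt0 ?powR_gt0.
  rewrite -(ler_pM2r P0); apply: le_trans.
    apply: ler_wpM2l; first exact: powR_ge0.
    apply: ler_wpM2l; [by rewrite mulr_ge0 ?powR_ge0 | exact: vol_lower].
  apply: le_trans upJ _; rewrite le_eqVlt; apply/orP; left; apply/eqP.
  rewrite powRB; last by apply/implyP => _; rewrite gt_eqF.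
  rewrite !powRN; field.
  by rewrite !gt_eqF // powR_gt0.
move=> up; have u0 : 0 <= u by exact: normr_ge0.
have -> : u = (u `^ p) `^ p^-1 by rewrite -powRrM mulfV ?gt_eqF // powRr1.
have -> : r `^ (s - Q / p) * (D `^ (- beta / p) * J `^ p^-1) =
    (r `^ (s * p - Q) * (D `^ (- beta) * J)) `^ p^-1.
  rewrite !powRM ?mulr_ge0 ?powR_ge0 ?(ltW J0) // -!powRrM; congr (_ `^ _ * _).
  by field; rewrite gt_eqF.
rewrite -powRM ?divr_ge0 ?mulr_ge0 ?powR_ge0 ?(ltW J0) ?(ltW c0) //.
have rhs0 : 0 <= 2 `^ `|beta| / c * (r `^ (s * p - Q) * (D `^ (- beta) * J)).
  by rewrite mulr_ge0 ?divr_ge0 ?mulr_ge0 ?powR_ge0 // ltW.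
by apply: ge0_ler_powR; rewrite ?nnegrE ?invr_ge0 ?powR_ge0 // ltW.
Qed.

(** Inside a Whitney ball the weight is constant up to a factor, and [f] is
    estimated pointwise.  The gradient takes over the part of the maximal
    function in Hedberg's argument. *)
Lemma whitney_pointwise_le : exists K : R, 0 < K /\
  forall f A h J x r, fractional_gradient s f A h -> 0 < J ->
  (\int[mu]_(y in [set: X]) ((h y `^ p)%:E * dist_pow E beta y) <= J%:E)%E ->
  0 < r -> 8 * r <= dist x E -> dist x E <= 16 * r ->
  `|f x - A x r| `^ q * dist x E `^ (q / p * (Q - s * p + beta) - Q) <=
     K * (h x `^ p * dist x E `^ beta * J `^ (q / p - 1)).
Proof.
have [K1 [K10 HK1]] := whitney_step_le.
have p1 := p_gt1; have p0 : 0 < p by lra.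
pose b := 2 `^ (Q / p - s) : R.
have tau0 : 0 < Q / p - s by rewrite subr_gt0 ltr_pdivlMr.
have b1 : 1 < b by exact: two_powR_gt1.
have b20 : 0 <= (1 - 2 `^ (- s))^-1 :> R.
  by rewrite invr_ge0 subr_ge0 ltW // two_powRN_lt1.
have b10 : 0 <= b / (b - 1) by rewrite divr_ge0 //; lra.
pose K := (1 - 2 `^ (- s))^-1 + K1 * (b / (b - 1)) + 1.
have K0 : 0 < K by rewrite ltr_wpDl // addr_ge0 // mulr_ge0 // ltW.
have [C [C0 HC]] :=
  hedberg_balance beta s_gt0 p_gt1 p_leq sp_ltQ q_le K0.
exists C; split=> // f A h J x r fAh J0 hJ r0 rD Dr.
have [h0 _ _ _] := fAh; set D := dist x E.
have D0 : 0 < D by rewrite /D; lra.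
have fr t : 0 < t -> `|f x - A x t| <= K * (t `^ s * h x).
  move=> t0; apply: le_trans (approximation_le x fAh t0) _.
  rewrite ler_wpM2r ?mulr_ge0 ?powR_ge0 // /K -addrA lerDl.
  by rewrite addr_ge0 // mulr_ge0 // ltW.
(* For [r / 2 ^+ N] the approximation is bounded by [h x], and the steps from
there up to [r] form a geometric sum dominated by the smallest radius. *)
apply: (HC _ _ _ _ r) => //; first exact: fr.
move=> N; have e0 : 0 < 2 ^+ N :> R by exact: exprn_gt0.
have rN : 0 < r / 2 ^+ N by rewrite divr_gt0.
set G := D `^ _ * J `^ _.
have G0 : 0 <= G by rewrite mulr_ge0 ?powR_ge0.
rewrite mulrDr; apply: le_trans (ler_distD (A x (r / 2 ^+ N)) _ _) _.
apply: lerD; first exact: fr.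
apply: (@le_trans _ _ (K1 * (r `^ (s - Q / p) * G) * \sum_(i < N) b ^+ i.+1)).
  elim: N {e0 rN} => [|N IH].
    by rewrite expr0 divr1 subrr normr0 big_ord0 mulr0.
  rewrite big_ord_recr /= mulrDr (le_trans (ler_distD (A x (r / 2 ^+ N)) _ _)) //.
  rewrite addrC lerD //.
  have e0 : 0 < 2 ^+ N :> R by exact: exprn_gt0.
  have e1 : 1 <= 2 ^+ N :> R by apply: exprn_ege1; lra.
  have := HK1 _ _ _ _ x (r / 2 ^+ N.+1) fAh J0 hJ.
  rewrite divr_gt0 ?exprn_gt0 // => /(_ isT).
  have -> : 2 * (r / 2 ^+ N.+1) = r / 2 ^+ N.
    by rewrite exprS; field; rewrite gt_eqF.
  have rND : r / 2 ^+ N <= dist x E.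
    by rewrite ler_pdivrMr //; nra.
  move=> /(_ rND) /le_trans; apply; rewrite -/D -/G powR_half //.
  by rewrite opprB -/b -!mulrA (mulrCA (b ^+ _)) (mulrC (b ^+ _)).
apply: (@le_trans _ _ (K1 * (r `^ (s - Q / p) * G) * (b / (b - 1) * b ^+ N))).
  rewrite ler_wpM2l ?geometric_growth_le //.
  by rewrite mulr_ge0 ?mulr_ge0 ?powR_ge0 // ltW.
rewrite powR_half // opprB -/b.
rewrite (_ : K1 * _ * _ = K1 * (b / (b - 1)) * (r `^ (s - Q / p) * b ^+ N * G)); last by ring.
rewrite ler_wpM2r ?mulr_ge0 ?powR_ge0 ?exprn_ge0 //; first lra.
by rewrite /K addrAC lerDr addr_ge0.
Qed.

End local_estimate.

(** * The estimate at all scales *)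

Section gradient_inequality.
Context d (R : realType) (X : measurableMetricType d R).
Variable mu : {measure set X -> \bar R}.
Hypothesis borelX : borel_sigma_algebra X.
Hypothesis mu_ball : ball_measure_pos_fin mu.
Variable CD : R.
Hypothesis doublingCD : forall x r, 0 < r -> vol mu x (2 * r) <= CD * vol mu x r.
Variables (c Q : R).
Hypothesis c_gt0 : 0 < c.
Hypothesis vol_lower : forall x r, 0 < r -> c * r `^ Q <= vol mu x r.
Variables (E : set X) (CE rho : R).
Hypothesis E0 : E !=set0.
Hypothesis E_closed : closed E.
Hypothesis CE1 : 1 <= CE.
Hypothesis rho0 : 0 <= rho.
Hypothesis codimE : forall e r r', E e -> 0 < r -> r < r' ->
  (mu (neighborhood E r `&` ball e r') <=
   (CE * (r / r') `^ rho * vol mu e r')%:E)%E.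
Variables (s p q beta : R).
Hypothesis s_gt0 : 0 < s.
Hypothesis p_gt1 : 1 < p.
Hypothesis p_leq : p <= q.
Hypothesis sp_ltQ : s * p < Q.
Hypothesis q_le : q <= Q * p / (Q - s * p).
Local Notation alpha := (q / p * (Q - s * p + beta) - Q).
Hypothesis rho_a : - alpha < rho.
Hypothesis rho_beta : 0 <= beta -> 0 < rho.
Local Notation vol := (vol mu).
Implicit Types (f h : X -> R) (A : X -> R -> R) (x y z : X).

(** Up to the factor [(dist y E / r) ^ (theta beta - beta)] this is the density
    of the energy within distance [18 * r] of [E].  The factor decays towards
    [E], so that the sum over dyadic [r] is at most alpha multiple of the energy. *)
Definition scale_energy h (r : R) y : \bar R :=
  ((h y `^ p)%:E *
   (r `^ (beta - theta beta) * (dist y E < 18 * r)%R%:R *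
    dist y E `^ theta beta)%:E)%E.

Lemma scale_energy_ge0 h r y : (0 <= scale_energy h r y)%E.
Proof. by rewrite mule_ge0 // lee_fin ?mulr_ge0 ?powR_ge0. Qed.

Lemma measurable_scale_energy h r : measurable_fun setT h ->
  measurable_fun setT (scale_energy h r).
Proof.
move=> mh; apply: emeasurable_funM; first exact: measurable_powR_EFin.
apply/measurable_EFinP; apply: measurable_funM; last exact: measurable_dist_powR.
apply: measurable_funM => //.
rewrite (_ : (fun y => _) = \1_(neighborhood E (18 * r))).
  by apply: measurable_indic; exact: measurable_neighborhood.
apply/funext => y; rewrite indicE; congr (nat_of_bool _)%:R.
by apply/idP/idP => [h1|/set_mem //]; rewrite inE.
Qed.

Lemma sum_scale_energy_le : exists C : R, 0 < C /\ forall h eps,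
  measurable_fun setT h -> 0 < eps ->
  (\sum_(n <oo) \int[mu]_(y in [set: X]) scale_energy h (2 ^+ n * eps) y <=
   C%:E * \int[mu]_(y in [set: X]) ((h y `^ p)%:E * dist_pow E beta y))%E.
Proof.
have [C [C0 HC]] := scales_overlap E beta.
exists C; split=> // h eps mh eps0.
have mhw : measurable_fun setT (fun y => (h y `^ p)%:E * dist_pow E beta y)%E.
  by apply: emeasurable_funM; [exact: measurable_powR_EFin | exact: measurable_dist_pow].
have hw0 y : (0 <= (h y `^ p)%:E * dist_pow E beta y)%E.
  by rewrite mule_ge0 ?dist_pow_ge0 // lee_fin powR_ge0.
have me n := measurable_scale_energy (2 ^+ n * eps) mh.
rewrite -integral_nneseries //; last by move=> *; exact: scale_energy_ge0.
rewrite -ge0_integralZl_EFin ?(ltW C0) //.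
apply: ge0_le_integral => //.
- by move=> y _; apply: nneseries_ge0 => n _ _; exact: scale_energy_ge0.
- by apply: ge0_emeasurable_sum => // n y _ _; exact: scale_energy_ge0.
- by apply: measurable_funeM.
move=> y _; rewrite /scale_energy nneseriesZl; last first.
  by move=> n _; rewrite lee_fin !mulr_ge0 ?powR_ge0.
by rewrite muleCA lee_wpmul2l ?HC // lee_fin powR_ge0.
Qed.

Definition ball_energy h z (r : R) : \bar R :=
  \int[mu]_(y in ball z (2 * r)) scale_energy h r y.

Lemma ball_energy_ge0 h z r : (0 <= ball_energy h z r)%E.
Proof. by apply: integral_ge0 => y _; exact: scale_energy_ge0. Qed.

Lemma integral_indicM (g : X -> \bar R) (B : set X) :
  (\int[mu]_(x in [set: X]) ((\1_B x)%:E * g x) = \int[mu]_(x in B) g x)%E.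
Proof.
rewrite [RHS]integral_mkcond; apply: eq_integral => x _.
by rewrite patchE indicE; case: ifP; rewrite ?mul1e ?mul0e.
Qed.

Lemma sum_ball_energy_le h r (ss : seq X) : measurable_fun setT h -> 0 < r ->
  pairwise (fun x y => r <= mdist x y) ss ->
  (\sum_(z <- ss) ball_energy h z r <=
   (CD ^+ 4)%:E * \int[mu]_(y in [set: X]) scale_energy h r y)%E.
Proof.
move=> mh r0 sep; have me := measurable_scale_energy r mh.
have e0 y : (0 <= scale_energy h r y)%E by exact: scale_energy_ge0.
have CD1 := CD_ge1 borelX mu_ball doublingCD.
rewrite /ball_energy; under eq_bigr do rewrite -integral_indicM.
have m1 z : measurable_fun setT
    (fun y => (\1_(ball z (2 * r)) y)%:E * scale_energy h r y)%E.
  apply: emeasurable_funM => //; apply/measurable_EFinP.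
  by apply: measurable_indic; exact: measurable_mball.
have p1 z y : (0 <= (\1_(ball z (2 * r)) y)%:E * scale_energy h r y)%E.
  by rewrite mule_ge0 // lee_fin indicE ler0n.
have CD0 : 0 <= CD by lra.
rewrite -ge0_integral_sum // -ge0_integralZl_EFin ?exprn_ge0 //.
apply: ge0_le_integral => //.
- by move=> y _; apply: sume_ge0 => z _; exact: p1.
- by apply: emeasurable_sum => z _; exact: m1.
- by apply: measurable_funeM.
move=> y _; rewrite -ge0_sume_distrl; last by move=> z _; rewrite lee_fin indicE ler0n.
rewrite lee_wpmul2r // sumEFin lee_fin.
have := overlap_net borelX mu_ball doublingCD 1 y r0 sep.
by rewrite expr1.
Qed.

(** The scale [r] is a single term of the sum over all scales. *)
Lemma ball_energy_le : exists C : R, 0 < C /\ forall h J z r,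
  measurable_fun setT h -> 0 < r ->
  (\int[mu]_(y in [set: X]) ((h y `^ p)%:E * dist_pow E beta y) <= J%:E)%E ->
  (ball_energy h z r <= (C * J)%:E)%E.
Proof.
have [C [C0 HC]] := sum_scale_energy_le.
exists C; split=> // h J z r mh r0 hJ.
apply: (@le_trans _ _ (C%:E * J%:E)%E); last by rewrite EFinM.
apply: (@le_trans _ _
    (C%:E * \int[mu]_(y in [set: X]) ((h y `^ p)%:E * dist_pow E beta y))%E).
  apply: le_trans (HC _ _ mh r0).
  apply: (@le_trans _ _ (\int[mu]_(y in [set: X]) scale_energy h (2 ^+ 0 * r) y)%E).
    rewrite expr0 mul1r; apply: ge0_subset_integral => //.
    - exact: measurable_mball.
    - exact: measurable_scale_energy.
    by move=> y _; exact: scale_energy_ge0.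
  apply: (nneseries_ge_term (u := fun n =>
    \int[mu]_(y in [set: X]) scale_energy h (2 ^+ n * r) y) 0)%E => n.
  by apply: integral_ge0 => y _; exact: scale_energy_ge0.
by apply: lee_wpmul2l => //; rewrite lee_fin ltW.
Qed.

(** The step is bounded by the weighted mean of [h ^ p].  Of the resulting power
    [q / p] of the energy of the ball one factor is kept, to be summed over
    balls and scales, and the rest is bounded by [J]. *)
Lemma global_step_le : exists K : R, 0 < K /\
  forall f A h J x z r, fractional_gradient s f A h -> 0 < J ->
  (\int[mu]_(y in [set: X]) ((h y `^ p)%:E * dist_pow E beta y) <= J%:E)%E ->
  0 < r -> dist x E <= 16 * r -> mdist z x < r ->
  `|A x r - A x (2 * r)| `^ q <=
    K * (r `^ (- alpha) / vol z r * fine (ball_energy h z r) * J `^ (q / p - 1)).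
Proof.
have [C1 [C10 HC1]] := integral_theta_ge borelX mu_ball doublingCD E0 CE1 rho0
  codimE rho_beta.
have [C2 [C20 HC2]] := ball_energy_le.
have c0 := c_gt0; have p1 := p_gt1; have pq := p_leq.
have p0 : 0 < p by lra.
have CD1 := CD_ge1 borelX mu_ball doublingCD.
have CD0 : 0 < CD by lra.
exists (CD / C1 * (CD / C1 * C2 / c) `^ (q / p - 1)); split.
  by rewrite mulr_gt0 ?powR_gt0 // ?mulr_gt0 ?divr_gt0 ?invr_gt0 //.
move=> f A h J x z r fAh J0 hJ r0 xr zx; have [h0 mh _ _] := fAh.
set u := `|_ - _|; have u0 : 0 <= u by exact: normr_ge0.
have V0 : 0 < vol z r by exact: vol_gt0.
have M0 := ball_energy_ge0 h z r.
have Mle := HC2 h J z r mh r0 hJ.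
have Mfin : ball_energy h z r \is a fin_num.
  by rewrite ge0_fin_numE // (le_lt_trans Mle) // ltry.
set M := fine _.
have ME : ball_energy h z r = M%:E by rewrite fineK.
rewrite ME !lee_fin in M0 Mle.
have mth := measurable_theta borelX E0 beta.
have th0 y : (0 <= (dist y E `^ theta beta)%:E)%E by rewrite lee_fin powR_ge0.
have up : u `^ p <= CD / C1 * (r `^ (s * p - beta) / vol z r) * M.
  have : ((u `^ p)%:E * (C1 * r `^ theta beta * vol x r)%:E <=
      (r `^ (s * p))%:E * ((r `^ (theta beta - beta))%:E * M%:E))%E.
    have SM := step_mean_le mu borelX p_gt1 x fAh r0 mth th0.
    apply: le_trans (le_trans SM _).
      apply: lee_wpmul2l; first by rewrite lee_fin powR_ge0.
      by apply: HC1 => //; lra.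
    apply: lee_wpmul2l; first by rewrite lee_fin powR_ge0.
    rewrite -ME -ge0_integralZl_EFin ?powR_ge0 //; last 3 first.
    - exact: measurable_mball.
    - by move=> y _; exact: scale_energy_ge0.
    - by apply: measurable_funTS; exact: measurable_scale_energy.
    have mhth : measurable_fun (ball x r)
        (fun y => (h y `^ p)%:E * (dist y E `^ theta beta)%:E)%E.
      apply: measurable_funTS; apply: emeasurable_funM => //.
      exact: measurable_powR_EFin.
    have mse : measurable_fun setT
        (fun y => (r `^ (theta beta - beta))%:E * scale_energy h r y)%E.
      by apply: measurable_funeM; exact: measurable_scale_energy.
    have se0 y : (0 <= (r `^ (theta beta - beta))%:E * scale_energy h r y)%E.
      by rewrite mule_ge0 ?scale_energy_ge0 // lee_fin powR_ge0.
    apply: (@le_trans _ _ (\int[mu]_(y in ball x r)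
        ((r `^ (theta beta - beta))%:E * scale_energy h r y))%E).
      apply: ge0_le_integral => //.
      - exact: measurable_mball.
      - by move=> y _; rewrite mule_ge0 // lee_fin powR_ge0.
      - exact: measurable_funTS.
      move=> y /in_ball xy; rewrite /scale_energy.
      have -> : dist y E < 18 * r.
        by have := dist_triangle y x E0; rewrite (metric_sym y x); lra.
      rewrite muleCA; apply: lee_wpmul2l; first by rewrite lee_fin powR_ge0.
      rewrite -EFinM lee_fin mulr1 mulrA.
      rewrite -powRD; last by apply/implyP => _; rewrite gt_eqF.
      by rewrite (_ : _ + _ = 0) ?powRr0 ?mul1r //; ring.
    apply: ge0_subset_integral => //.
    - exact: measurable_mball.
    - exact: measurable_mball.
    - exact: measurable_funTS.
    by apply: ball_sub; lra.
  rewrite -!EFinM lee_fin => uM.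
  have Vx : vol z r <= CD * vol x r.
    have := @vol_compare _ _ _ _ borelX mu_ball _ doublingCD 1 x z r r r0 r0.
    by rewrite !expr1; apply; rewrite metric_sym; lra.
  have P0 : 0 < C1 * r `^ beta * vol z r by rewrite !mulr_gt0 ?powR_gt0.
  rewrite -(ler_pM2r P0).
  apply: (@le_trans _ _ (u `^ p * (C1 * r `^ beta * (CD * vol x r)))).
    rewrite ler_wpM2l ?powR_ge0 // ler_wpM2l // mulr_ge0 ?powR_ge0 //.
    exact: ltW.
  have rth : r `^ theta beta = r `^ (theta beta - beta) * r `^ beta.
    rewrite -powRD; first by congr (_ `^ _); ring.
    by apply/implyP => _; rewrite gt_eqF.
  have rsp : r `^ (s * p) = r `^ (s * p - beta) * r `^ beta.
    rewrite -powRD; first by congr (_ `^ _); ring.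
    by apply/implyP => _; rewrite gt_eqF.
  have T0 : 0 < r `^ (theta beta - beta) by exact: powR_gt0.
  have {}uM : u `^ p * (C1 * r `^ beta * vol x r) <= r `^ (s * p) * M.
    rewrite -(ler_pM2l T0); move: uM; rewrite rth.
    by congr (is_true (_ <= _)); ring.
  apply: (@le_trans _ _ (CD * (r `^ (s * p) * M))).
    apply: le_trans (ler_wpM2l (ltW CD0) uM).
    by rewrite le_eqVlt; apply/orP; left; apply/eqP; ring.
  rewrite rsp le_eqVlt; apply/orP; left; apply/eqP; field.
  by rewrite !gt_eqF.
have up2 : u `^ p <= CD / C1 * C2 / c * (r `^ (s * p - beta - Q) * J).
  apply: le_trans up _.
  have Vlow := vol_lower z r0.
  have rQ : r `^ (s * p - beta) = r `^ (s * p - beta - Q) * r `^ Q.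
    rewrite -powRD; first by congr (_ `^ _); ring.
    by apply/implyP => _; rewrite gt_eqF.
  have h1 : r `^ Q / vol z r <= c^-1.
    by rewrite ler_pdivrMr // ler_pdivlMl.
  rewrite rQ.
  rewrite (_ : CD / C1 * _ * M =
    CD / C1 * r `^ (s * p - beta - Q) * ((r `^ Q / vol z r) * M)); last by ring.
  rewrite (_ : CD / C1 * C2 / c * _ =
    CD / C1 * r `^ (s * p - beta - Q) * (c^-1 * (C2 * J))); last by ring.
  apply: ler_wpM2l; first by rewrite mulr_ge0 ?powR_ge0 // divr_ge0 // ltW.
  by apply: ler_pM => //; rewrite divr_ge0 ?powR_ge0 // ltW.
have k0 : 0 <= q / p - 1.
  by rewrite subr_ge0 ler_pdivlMr // mul1r.
have -> : u `^ q = u `^ p * (u `^ p) `^ (q / p - 1).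
  have [->|un0] := eqVneq u 0.
    have qn : q != 0 by rewrite gt_eqF //; lra.
    by rewrite (powR0 qn) (powR0 (lt0r_neq0 p0)) mul0r.
  rewrite -powRrM -powRD; last by apply/implyP.
  by congr (_ `^ _); field; rewrite gt_eqF.
have B0 : 0 <= CD / C1 * C2 / c.
  by rewrite !mulr_ge0 ?invr_ge0 ?ltW.
apply: (@le_trans _ _ (CD / C1 * (r `^ (s * p - beta) / vol z r) * M *
    (CD / C1 * C2 / c * (r `^ (s * p - beta - Q) * J)) `^ (q / p - 1))).
  apply: ler_pM; rewrite ?powR_ge0 //.
  apply: ge0_ler_powR => //; rewrite nnegrE ?powR_ge0 //.
  by rewrite mulr_ge0 // mulr_ge0 ?powR_ge0 ?(ltW J0).
have rJ0 : 0 <= r `^ (s * p - beta - Q) * J by rewrite mulr_ge0 ?powR_ge0 ?(ltW J0).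
rewrite (powRM _ B0 rJ0) (powRM _ (powR_ge0 _ _) (ltW J0)) -powRrM.
have -> : r `^ (- alpha) =
    r `^ (s * p - beta) * r `^ ((s * p - beta - Q) * (q / p - 1)).
  rewrite -powRD; first by congr (_ `^ _); ring.
  by apply/implyP => _; rewrite gt_eqF.
rewrite le_eqVlt; apply/orP; left; apply/eqP; ring.
Qed.

(** Any number strictly between [0] and [rho + alpha]: positive for the sum over
    scales to converge, and below [rho + alpha] for [alpha - zeta] to be an
    admissible exponent of the distance. *)
Local Notation zeta := ((rho + alpha) / 2).

Definition vanishes_at_infinity A : Prop :=
  forall x e, 0 < e -> exists r0, forall r, r0 <= r -> `|A x r| <= e.

(** The factor [2 ^ (n * zeta)] of the large step turns into a power of the ratio
    of the scale to the distance, which lowers the exponent of the distance to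
    [alpha - zeta]; this is still above [- rho]. *)
Lemma local_or_large_step : exists K : R, 0 < K /\
  forall f A h J x eps, fractional_gradient s f A h -> vanishes_at_infinity A ->
  0 < J ->
  (\int[mu]_(y in [set: X]) ((h y `^ p)%:E * dist_pow E beta y) <= J%:E)%E ->
  0 < eps -> 8 * eps <= dist x E ->
  `|f x| `^ q * dist x E `^ alpha <=
     K * (h x `^ p * dist x E `^ beta * J `^ (q / p - 1)) \/
  exists n, dist x E <= 16 * (2 ^+ n * eps) /\
    `|f x| `^ q * dist x E `^ alpha <= K * ((2 ^+ n * eps) `^ zeta *
      `|A x (2 ^+ n * eps) - A x (2 * (2 ^+ n * eps))| `^ q) *
      dist x E `^ (alpha - zeta).
Proof.
have p1 := p_gt1; have pq := p_leq; have q0 : 0 < q by lra.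
have z0 : 0 < zeta by have := rho_a; lra.
have [K1 [K10 HK1]] := whitney_pointwise_le borelX mu_ball c_gt0 vol_lower E0
  beta s_gt0 p_gt1 p_leq sp_ltQ q_le.
have zq : 0 < zeta / q by rewrite divr_gt0.
have [K2 [K20 HK2]] := large_step zq.
have e40 : 0 < 4 `^ q * K1 by rewrite mulr_gt0 ?powR_gt0.
have e16 : 0 < K2 `^ q * 16 `^ zeta by rewrite mulr_gt0 ?powR_gt0.
exists (4 `^ q * K1 + K2 `^ q * 16 `^ zeta); split; first exact: addr_gt0.
move=> f A h J x eps fAh A0 J0 hJ eps0 xeps.
set D := dist x E; have D0 : 0 < D by rewrite /D; lra.
have eD : eps <= D / 8 by rewrite ler_pdivlMr // mulrC.
have [m [m1 m2]] := dyadic_floor eps0 eD.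
set r := 2 ^+ m * eps; have r0 : 0 < r by rewrite mulr_gt0 // exprn_gt0.
have rD : 8 * r <= D by rewrite /r; lra.
have Dr : D <= 16 * r by move: m2; rewrite exprS /r; lra.
have lim e : 0 < e -> exists n, `|A x (2 ^+ n * r)| <= e.
  move=> e0; have [r1 Hr1] := A0 x e e0.
  exists (Num.truncn (r1 / r)).+1; apply: Hr1.
  rewrite -ler_pdivrMr // ltW // (lt_trans (truncnS_gt _)) // -natrX ltr_nat.
  exact: ltn_expl.
have [h1|[i hi]] := HK2 (f x) (fun n => A x (2 ^+ n * r)) lim.
  left; rewrite expr0 mul1r in h1.
  apply: (@le_trans _ _ ((4 `^ q * K1) *
      (h x `^ p * D `^ beta * J `^ (q / p - 1)))); last first.
    by rewrite ler_wpM2r ?mulr_ge0 ?powR_ge0 // lerDl ltW.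
  rewrite -[leRHS]mulrA; have HH := HK1 f A h J x r fAh J0 hJ r0 rD Dr.
  apply: le_trans (ler_wpM2l (powR_ge0 4 q) HH).
  rewrite [leRHS]mulrA ler_wpM2r ?powR_ge0 // -powRM //.
  by rewrite ge0_ler_powR ?nnegrE ?mulr_ge0 // ltW.
right; exists (i + m)%N.
have -> : 2 ^+ (i + m) * eps = 2 ^+ i * r by rewrite exprD mulrA.
set t := 2 ^+ i * r in hi *.
have i1 : 1 <= 2 ^+ i :> R by apply: exprn_ege1; lra.
have rt : r <= t by rewrite ler_peMl // ltW.
split; first lra.
rewrite (_ : 2 ^+ i.+1 * r = 2 * t) in hi; last by rewrite /t exprS mulrA.
set u := `|_ - _| in hi *.
have u0 : 0 <= u by exact: normr_ge0.
apply: (@le_trans _ _ (K2 `^ q * 16 `^ zeta * (t `^ zeta * u `^ q) *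
    D `^ (alpha - zeta))); last first.
  by rewrite ler_wpM2r ?powR_ge0 // ler_wpM2r ?mulr_ge0 ?powR_ge0 // lerDr ltW.
have b0 : 0 < (2 `^ (zeta / q)) ^+ i :> R by rewrite exprn_gt0 // powR_gt0.
apply: (@le_trans _ _ ((K2 * (2 `^ (zeta / q)) ^+ i * u) `^ q * D `^ alpha)).
  rewrite ler_wpM2r ?powR_ge0 //.
  by rewrite ge0_ler_powR ?nnegrE ?mulr_ge0 // ltW.
have -> : (K2 * (2 `^ (zeta / q)) ^+ i * u) `^ q =
    K2 `^ q * (2 ^+ i) `^ zeta * u `^ q.
  rewrite powRM ?mulr_ge0 ?(ltW K20) ?(ltW b0) //.
  rewrite powRM ?(ltW K20) ?(ltW b0) // powR_exprn // -[in LHS]powRrM.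
  by rewrite divfK ?gt_eqF.
have -> : D `^ alpha = D `^ (alpha - zeta) * D `^ zeta.
  rewrite -powRD; first by congr (_ `^ _); ring.
  by apply/implyP => _; rewrite gt_eqF.
have key : (2 ^+ i) `^ zeta * D `^ zeta <= 16 `^ zeta * t `^ zeta.
  rewrite -!powRM ?(ltW D0) ?exprn_ge0 //; last by rewrite (le_trans _ rt) // ltW.
  apply: ge0_ler_powR; rewrite ?nnegrE ?(ltW z0) //.
  - by rewrite mulr_ge0 ?exprn_ge0 // ltW.
  - by rewrite mulr_ge0 // (le_trans _ rt) // ltW.
  by rewrite /t mulrCA ler_wpM2l // exprn_ge0.
have P0 : 0 <= K2 `^ q * u `^ q * D `^ (alpha - zeta).
  by rewrite !mulr_ge0 ?powR_ge0.
by have := ler_wpM2l P0 key; congr (is_true (_ <= _)); ring.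
Qed.

(** Pointwise the integrand is at most [H], the local part, or one of the terms
    [T n z], the part of a ball of the net at scale [n].  Removing a
    neighborhood of [E] leaves the scales [2 ^ n * eps]; the constant does not
    depend on [eps]. *)
Lemma integral_away_le : exists C : R, 0 < C /\
  forall f A h J x0 R0 eps, fractional_gradient s f A h ->
  vanishes_at_infinity A -> measurable_fun setT f -> 0 < J ->
  (\int[mu]_(y in [set: X]) ((h y `^ p)%:E * dist_pow E beta y) <= J%:E)%E ->
  0 < eps ->
  (\int[mu]_(x in ball x0 R0 `\` neighborhood E (8 * eps))
     ((`|f x| `^ q)%:E * dist_pow E alpha x) <= (C * J `^ (q / p))%:E)%E.
Proof.
have p1 := p_gt1; have pq := p_leq; have p0 : 0 < p by lra.
have [K1 [K10 HK1]] := local_or_large_step.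
have [K2 [K20 HK2]] := global_step_le.
have z0 : 0 < zeta by have := rho_a; lra.
have zrho : zeta - alpha < rho by have := rho_a; lra.
have [C3 [C30 HC3]] := integral_dist_powN_le borelX mu_ball doublingCD E0 CE1
  rho0 codimE zrho.
have [C4 [C40 HC4]] := sum_scale_energy_le.
have CD1 := CD_ge1 borelX mu_ball doublingCD.
have CD0 : 0 < CD by lra.
have [C5 [C50 HC5]] := ball_energy_le.
exists (K1 + K1 * K2 * C3 * CD ^+ 4 * C4); split.
  by rewrite addr_gt0 // !mulr_gt0 // exprn_gt0.
move=> f A h J x0 R0 eps fAh A0 mf J0 hJ eps0; have [h0 mh _ _] := fAh.
pose r n := 2 ^+ n * eps; have r0 n : 0 < r n by rewrite mulr_gt0 // exprn_gt0.
have [net Hnet] := choice (fun n =>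
  exists_net borelX mu_ball doublingCD x0 R0 (r0 n)).
pose k := q / p - 1; pose M n z := fine (ball_energy h z (r n)).
have ME n z : ball_energy h z (r n) = (M n z)%:E.
  rewrite fineK // ge0_fin_numE ?ball_energy_ge0 //.
  by rewrite (le_lt_trans (HC5 h J z (r n) mh (r0 n) hJ)) // ltry.
have M0 n z : 0 <= M n z by rewrite -lee_fin -ME ball_energy_ge0.
pose coef n z := K1 * K2 * (r n `^ zeta * (r n `^ (- alpha) / vol z (r n)) * M n z *
  J `^ k) * (dist z E < 17 * r n)%R%:R.
have coef0 n z : 0 <= coef n z.
  have V0 : 0 < vol z (r n) by exact: vol_gt0.
  by rewrite /coef !mulr_ge0 ?powR_ge0 ?invr_ge0 // ltW.
pose T n z x := ((coef n z)%:E * ((\1_(ball z (r n)) x)%:E *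
  dist_pow E (alpha - zeta) x))%E.
have T0 n z x : (0 <= T n z x)%E.
  by rewrite !mule_ge0 ?dist_pow_ge0 // lee_fin // indicE ler0n.
have mi n z : measurable_fun setT
    (fun x => ((\1_(ball z (r n)) x)%:E * dist_pow E (alpha - zeta) x)%E).
  apply: emeasurable_funM; last exact: measurable_dist_pow.
  by apply/measurable_EFinP; apply: measurable_indic; exact: measurable_mball.
have mT n z : measurable_fun setT (T n z) by exact: measurable_funeM.
pose S n x := (\sum_(z <- net n) T n z x)%E.
have S0 n x : (0 <= S n x)%E by apply: sume_ge0.
have mS n : measurable_fun setT (S n) by exact: emeasurable_sum.
pose H x := ((K1 * J `^ k)%:E * ((h x `^ p)%:E * dist_pow E beta x))%E.
have KJ0 : 0 <= K1 * J `^ k by rewrite mulr_ge0 ?powR_ge0 ?ltW.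
have hw0 x : (0 <= (h x `^ p)%:E * dist_pow E beta x)%E.
  by rewrite mule_ge0 ?dist_pow_ge0 // lee_fin powR_ge0.
have mhw : measurable_fun setT (fun x => (h x `^ p)%:E * dist_pow E beta x)%E.
  by apply: emeasurable_funM; [exact: measurable_powR_EFin | exact: measurable_dist_pow].
have H0 x : (0 <= H x)%E by rewrite mule_ge0 // lee_fin.
have mH : measurable_fun setT H by exact: measurable_funeM.
have mSS : measurable_fun setT (fun x => \sum_(n <oo) S n x)%E.
  by apply: ge0_emeasurable_sum => // n x _ _; exact: S0.
have SS0 x : (0 <= \sum_(n <oo) S n x)%E by exact: nneseries_ge0.
have mW : measurable (ball x0 R0 `\` neighborhood E (8 * eps)).
  by apply: measurableD; [exact: measurable_mball | exact: measurable_neighborhood].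
have mfq : measurable_fun setT (fun x => (`|f x| `^ q)%:E * dist_pow E alpha x)%E.
  apply: emeasurable_funM; last exact: measurable_dist_pow.
  by apply: measurable_powR_EFin; exact: measurableT_comp.
have fq0 x : (0 <= (`|f x| `^ q)%:E * dist_pow E alpha x)%E.
  by rewrite mule_ge0 ?dist_pow_ge0 // lee_fin powR_ge0.
apply: (@le_trans _ _ (\int[mu]_(x in [set: X]) (H x + \sum_(n <oo) S n x))%E).
  apply: (@le_trans _ _ (\int[mu]_(x in ball x0 R0 `\` neighborhood E (8 * eps))
      (H x + \sum_(n <oo) S n x))%E); last first.
    apply: ge0_subset_integral => //; first exact: emeasurable_funD.
    by move=> x _; rewrite adde_ge0.
  apply: ge0_le_integral => //.
  - exact: measurable_funTS.
  - by apply: measurable_funTS; exact: emeasurable_funD.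
  move=> x [/in_ball xR /negP]; rewrite -leNgt => xE.
  have D0 : 0 < dist x E by lra.
  have dpE b : dist_pow E b x = (dist x E `^ b)%:E by rewrite /dist_pow (gt_eqF D0).
  rewrite dpE -EFinM.
  have [loc|[n [xn step]]] := HK1 f A h J x eps fAh A0 J0 hJ eps0 xE.
    apply: (@le_trans _ _ (H x)); last by rewrite leeDl.
    rewrite /H dpE -!EFinM lee_fin; apply: le_trans loc _.
    by rewrite -/k le_eqVlt; apply/orP; left; apply/eqP; ring.
  apply: (@le_trans _ _ (\sum_(n <oo) S n x)%E); last by rewrite leeDr.
  apply: le_trans (nneseries_ge_term n (fun n => S0 n x)).
  have [sep cov] := Hnet n; have [z zn zx] := cov x xR.
  apply: (@le_trans _ _ (T n z x)); last first.
    by rewrite /S (big_rem z zn) /= leeDl // sume_ge0.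
  rewrite /T indicE mem_set ?mul1e; last by apply/in_ball.
  rewrite dpE -EFinM lee_fin; apply: le_trans step _.
  rewrite ler_wpM2r ?powR_ge0 // /coef.
  have -> : dist z E < 17 * r n.
    by have := dist_triangle z x E0; rewrite /r in zx xn *; lra.
  rewrite mulr1 -[leRHS]mulrA ler_wpM2l ?(ltW K10) //.
  have := HK2 f A h J x z (r n) fAh J0 hJ (r0 n) xn zx.
  move=> /(ler_wpM2l (powR_ge0 (r n) zeta)) /le_trans; apply.
  by rewrite -/k -/(M n z) le_eqVlt; apply/orP; left; apply/eqP; ring.
rewrite ge0_integralD //.
rewrite mulrDl EFinD; apply: leeD.
  rewrite ge0_integralZl_EFin //.
  apply: (@le_trans _ _ ((K1 * J `^ k)%:E * J%:E)%E).
    by apply: lee_wpmul2l => //; rewrite lee_fin.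
  rewrite -EFinM lee_fin -mulrA ler_wpM2l ?(ltW K10) //.
  rewrite -{2}[J]powRr1 ?(ltW J0) // -powRD; last by apply/implyP => _; rewrite gt_eqF.
  by rewrite /k subrK.
rewrite integral_nneseries //.
have term n : (\int[mu]_(x in [set: X]) S n x <=
    (K1 * K2 * C3 * CD ^+ 4 * J `^ k)%:E *
    \int[mu]_(y in [set: X]) scale_energy h (r n) y)%E.
  rewrite /S ge0_integral_sum //.
  apply: (@le_trans _ _ ((K1 * K2 * C3 * J `^ k)%:E *
    \sum_(z <- net n) ball_energy h z (r n))%E).
    rewrite ge0_sume_distrr; last by move=> z _; exact: ball_energy_ge0.
    apply: lee_sum => z _; rewrite /T ge0_integralZl_EFin //; last first.
      by move=> x _; rewrite mule_ge0 ?dist_pow_ge0 // lee_fin indicE ler0n.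
    rewrite integral_indicM ME -EFinM /coef.
    case: ltP => zE; last first.
      by rewrite mulr0 mul0e lee_fin !mulr_ge0 ?M0 ?powR_ge0 // ltW.
    rewrite mulr1 (_ : alpha - zeta = - (zeta - alpha)); last by ring.
    apply: le_trans (lee_wpmul2l _ (HC3 z (r n) (r0 n) zE)) _.
      have V0 : 0 < vol z (r n) by exact: vol_gt0.
      by rewrite lee_fin !mulr_ge0 ?powR_ge0 ?invr_ge0 // ltW.
    rewrite -EFinM lee_fin le_eqVlt; apply/orP; left; apply/eqP.
    have -> : r n `^ (- (zeta - alpha)) = (r n `^ zeta)^-1 * (r n `^ (- alpha))^-1.
      rewrite -!powRN -powRD; first by congr (_ `^ _); ring.
      by apply/implyP => _; rewrite gt_eqF.
    by field; rewrite !gt_eqF ?powR_gt0 ?vol_gt0.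
  have [sep _] := Hnet n.
  have := sum_ball_energy_le mh (r0 n) sep.
  move=> /(lee_wpmul2l (_ : (0 <= (K1 * K2 * C3 * J `^ k)%:E)%E)) h1.
  apply: le_trans (h1 _) _; first by rewrite lee_fin !mulr_ge0 ?powR_ge0 ?ltW.
  rewrite muleA -EFinM le_eqVlt; apply/orP; left; apply/eqP.
  by congr (_%:E * _)%E; ring.
have se0 n : (0 <= \int[mu]_(y in [set: X]) scale_energy h (r n) y)%E.
  by apply: integral_ge0 => y _; exact: scale_energy_ge0.
apply: (@le_trans _ _ (\sum_(n <oo) (K1 * K2 * C3 * CD ^+ 4 * J `^ k)%:E *
    \int[mu]_(y in [set: X]) scale_energy h (r n) y)%E).
  by apply: lee_nneseries => // n _ _; exact: integral_ge0.
rewrite nneseriesZl //.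
have KK0 : 0 <= K1 * K2 * C3 * CD ^+ 4 * J `^ k.
  by rewrite !mulr_ge0 ?exprn_ge0 ?powR_ge0 ?ltW.
apply: (@le_trans _ _ ((K1 * K2 * C3 * CD ^+ 4 * J `^ k)%:E * (C4%:E * J%:E))%E).
  apply: lee_wpmul2l; first by rewrite lee_fin.
  apply: le_trans (HC4 h eps mh eps0) _.
  by apply: lee_wpmul2l => //; rewrite lee_fin ltW.
rewrite -!EFinM lee_fin.
have -> : J `^ (q / p) = J `^ k * J.
  rewrite -{3}[J]powRr1 ?(ltW J0) // -powRD; last by apply/implyP => _; rewrite gt_eqF.
  by rewrite /k subrK.
by rewrite le_eqVlt; apply/orP; left; apply/eqP; ring.
Qed.

Lemma integral_dist_pow_le : exists C : R, 0 < C /\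
  forall f A h J x0 R0, fractional_gradient s f A h ->
  vanishes_at_infinity A -> measurable_fun setT f ->
  (forall y, ~ ball x0 R0 y -> f y = 0) -> 0 < J ->
  (\int[mu]_(y in [set: X]) ((h y `^ p)%:E * dist_pow E beta y) <= J%:E)%E ->
  (\int[mu]_(x in [set: X]) ((`|f x| `^ q)%:E * dist_pow E alpha x) <=
     (C * J `^ (q / p))%:E)%E.
Proof.
have [C [C0 HC]] := integral_away_le; have p1 := p_gt1; have pq := p_leq.
exists C; split=> // f A h J x0 R0 fAh A0 mf fsupp J0 hJ.
set g := fun x => ((`|f x| `^ q)%:E * dist_pow E alpha x)%E.
have mfq : measurable_fun setT (fun x => (`|f x| `^ q)%:E : \bar R).
  by apply: measurable_powR_EFin; exact: measurableT_comp.
have mg : measurable_fun setT g.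
  by apply: emeasurable_funM => //; exact: measurable_dist_pow.
have fq0 x : (0 <= (`|f x| `^ q)%:E)%E by rewrite lee_fin powR_ge0.
have g0 x : (0 <= g x)%E by rewrite mule_ge0 ?dist_pow_ge0.
have mE : measurable E by exact: measurable_closed_set.
have gE : (\int[mu]_(x in E) g x = 0)%E.
  apply: (integral_on_closed_set borelX mu_ball E0 CE1 codimE E_closed) => //.
  by have [a0|a0] := ltP 0 alpha; [left | right; have := rho_a; lra].
(* These sets exhaust the points of the ball off [E]. *)
pose F n := ball x0 R0 `\` neighborhood E (8 * n.+1%:R^-1).
have mF n : measurable (F n).
  by apply: measurableD; [exact: measurable_mball | exact: measurable_neighborhood].
have FE : \bigcup_n F n = ball x0 R0 `\` E.
  apply/seteqP; split=> x.
    move=> [n _ [xR nx]]; split=> // Ex; apply: nx.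
    by rewrite /neighborhood /= dist_closed // mulr_gt0.
  move=> [xR nEx]; have x0' := dist_gt0 E0 E_closed nEx.
  exists (Num.truncn (8 / dist x E)) => //; split=> //.
  rewrite /neighborhood /=; apply/negP; rewrite -leNgt ler_pdivrMr //.
  by rewrite mulrC -ler_pdivrMr // ltW // truncnS_gt.
have split1 : (\int[mu]_(x in [set: X]) g x = \int[mu]_(x in \bigcup_n F n) g x)%E.
  have -> : [set: X] = E `|` ~` E by rewrite setUCr.
  rewrite ge0_integral_setU //; last 3 first.
  - exact: measurableC.
  - by rewrite setUCr.
  - by apply/disj_setPCl.
  rewrite gE add0e FE -(integral_indicM g (~` E)).
  rewrite -(integral_indicM g (_ `\` E)); apply: eq_integral => x _.
  have [xR|xR] := pselect (ball x0 R0 x).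
    rewrite !indicE; congr ((nat_of_bool _)%:R%:E * _)%E.
    by apply/idP/idP => /set_mem h1; apply/mem_set; [split | case: h1].
  have qn : q != 0 by rewrite gt_eqF //; lra.
  by rewrite /g fsupp // normr0 (powR0 qn) mul0e !mule0.
rewrite split1.
have nd : nondecreasing_seq F.
  apply/nondecreasing_seqP => n; rewrite subsetEset => x [xR nx]; split=> //.
  move=> hx; apply: nx; move: hx; rewrite /neighborhood /= => /lt_le_trans; apply.
  by rewrite ler_pM2l // lef_pV2 ?posrE // ler_nat.
have cv := @ge0_nondecreasing_set_cvg_integral _ _ _ F g mu nd mF
  (fun n => measurable_funTS mg) (fun n x _ => g0 x).
rewrite -(cvg_lim _ cv) //; apply: lime_le; first by apply/cvg_ex; eexists; exact: cv.
by apply: nearW => n; exact: (HC f A h J x0 R0 _ fAh A0 mf J0 hJ).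
Qed.

End gradient_inequality.

(** * Averages of Lipschitz functions *)

(** Comparison through the simple functions below [f].  It is applied with [g]
    built from an inner integral that depends on [x]. *)
Lemma ge0_le_integral_lower d (T : measurableType d) (R : realType)
    (mu : {measure set T -> \bar R}) (f g : T -> \bar R) :
  (forall x, 0 <= f x)%E -> (forall x, f x <= g x)%E ->
  (\int[mu]_(x in [set: T]) f x <= \int[mu]_(x in [set: T]) g x)%E.
Proof.
move=> f0 fg; have g0 x : (0 <= g x)%E by exact: le_trans (f0 x) (fg x).
rewrite !ge0_integralTE //; apply: le_ereal_sup => _ [u /= uf <-].
by exists u => // x; exact: le_trans (uf x) (fg x).
Qed.

Section averages.
Context d (R : realType) (X : measurableMetricType d R).
Variable mu : {measure set X -> \bar R}.
Hypothesis borelX : borel_sigma_algebra X.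
Hypothesis mu_ball : ball_measure_pos_fin mu.
Variable CD : R.
Hypothesis doublingCD : forall x r, 0 < r -> vol mu x (2 * r) <= CD * vol mu x r.
Variables (c Q : R).
Hypothesis c_gt0 : 0 < c.
Hypothesis vol_lower : forall x r, 0 < r -> c * r `^ Q <= vol mu x r.
Hypothesis Q_gt0 : 0 < Q.
Variables s t : R.
Hypothesis s_gt0 : 0 < s.
Hypothesis s_lt1 : s < 1.
Hypothesis t_ge1 : 1 <= t.
Variables (f : X -> R) (L : R) (x1 : X) (r1 : R).
Hypothesis L0 : 0 <= L.
Hypothesis f_lip : forall x y, `|f x - f y| <= L * mdist x y.
Hypothesis r10 : 0 < r1.
Hypothesis f_supp : forall y, ~ ball x1 r1 y -> f y = 0.
Local Notation vol := (vol mu).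
Implicit Types x y z : X.

Let bound := `|f x1| + L * r1.

Lemma bound_ge0 : 0 <= bound.
Proof. by rewrite addr_ge0 // mulr_ge0 // ltW // r10. Qed.

Lemma lip0_bounded y : `|f y| <= bound.
Proof.
have [/in_ball yr|/f_supp ->] := pselect (ball x1 r1 y); last first.
  by rewrite normr0 bound_ge0.
have h1 := f_lip y x1; have h2 := ler_normD (f x1) (f y - f x1).
have h3 : L * mdist y x1 <= L * r1.
  by rewrite ler_wpM2l // ?L0 // metric_sym ltW.
by rewrite addrC subrK in h2; rewrite /bound; lra.
Qed.

Lemma measurable_lipschitz : measurable_fun setT f.
Proof.
apply: measurable_fun_lsc => // a; rewrite openE => x /= ax.
have L1 : 0 < L + 1 by have := L0; lra.
apply/nbhs_ballP; exists ((f x - a) / (L + 1)) => /=.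
  by rewrite divr_gt0 // subr_gt0.
move=> y /in_ball; rewrite ltr_pdivlMr // => xy /=.
have := ler_norm (f x - f y); have := f_lip x y; have := mdist_ge0 x y; nra.
Qed.

Lemma integrable_ball x r (g : X -> R) B : measurable_fun setT g ->
  (forall z, `|g z| <= B) -> 0 < r -> mu.-integrable (ball x r) (EFin \o g).
Proof.
move=> mg gB r0; apply: measurable_bounded_integrable.
- exact: measurable_mball.
- by have /andP[] := mu_ball x r0.
- exact: measurable_funTS.
exists B; split; first by rewrite num_real.
by move=> M BM z _ /=; exact: le_trans (gB z) (ltW BM).
Qed.

Definition avg x r : R := Rintegral mu (ball x r) f / vol x r.

Lemma measurable_osc y : measurable_fun setT (fun z => `|f y - f z|).
Proof.
apply: measurableT_comp => //; apply: measurable_funB => //.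
exact: measurable_lipschitz.
Qed.

Lemma avg_dist_le x y r : 0 < r ->
  ((`|f y - avg x r| * vol x r)%:E <=
   \int[mu]_(z in ball x r) (`|f y - f z|)%:E)%E.
Proof.
move=> r0; have V0 : 0 < vol x r by exact: vol_gt0.
have mf := measurable_lipschitz.
have i1 := integrable_ball x mf lip0_bounded r0.
have i2 : mu.-integrable (ball x r) (EFin \o cst (f y)).
  by apply: (@integrable_ball x r (cst (f y)) `|f y|).
have i3 : mu.-integrable (ball x r) (EFin \o (fun z => f y - f z)).
  by have := integrableB (measurable_mball borelX x r) i2 i1.
have i4 : mu.-integrable (ball x r) (EFin \o (fun z => `|f y - f z|)).
  by have := integrable_norm i3.
have mB := measurable_mball borelX x r.
have eq1 : (f y - avg x r) * vol x r = Rintegral mu (ball x r) (fun z => f y - f z).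
  rewrite (RintegralB mB i2 i1) Rintegral_cst // mulrBl /avg divfK //.
  by rewrite gt_eqF.
rewrite -[vol x r]gtr0_norm // -normrM eq1.
have := le_normr_Rintegral mB i3; rewrite -lee_fin => /le_trans; apply.
rewrite /Rintegral fineK //; exact: integrable_fin_num.
Qed.

Lemma avg_close x r : 0 < r -> `|f x - avg x r| <= L * r.
Proof.
move=> r0; have V0 : 0 < vol x r by exact: vol_gt0.
rewrite -(ler_pM2r V0) -lee_fin; apply: le_trans (avg_dist_le x x r0) _.
rewrite EFinM -volE // -integral_cst; last exact: measurable_mball.
apply: ge0_le_integral => //.
- exact: measurable_mball.
- by apply/measurable_EFinP; apply: measurable_funTS; exact: measurable_osc.
move=> z /in_ball xz; rewrite lee_fin; apply: le_trans (f_lip x z) _.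
by rewrite ler_wpM2l ?L0 // ltW.
Qed.

(** The integral of [|f|] over any ball is at most that over the support. *)
Lemma avg_vol_le x r : 0 < r -> `|avg x r| * vol x r <= bound * vol x1 r1.
Proof.
move=> r0; have V0 : 0 < vol x r by exact: vol_gt0.
have mf := measurable_lipschitz; have b0 := bound_ge0.
have i1 := integrable_ball x mf lip0_bounded r0.
have mB := measurable_mball borelX x r.
have i4 : mu.-integrable (ball x r) (EFin \o (fun z => `|f z|)).
  by have := integrable_norm i1.
rewrite -[vol x r]gtr0_norm // -normrM /avg divfK ?gt_eqF //.
apply: le_trans (le_normr_Rintegral mB i1) _.
rewrite -lee_fin /Rintegral fineK; last exact: integrable_fin_num.
apply: (@le_trans _ _ (\int[mu]_(z in ball x r)
    (bound%:E * (\1_(ball x1 r1) z)%:E))%E).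
  apply: ge0_le_integral => //.
  - by apply/measurable_EFinP; apply: measurable_funTS; exact: measurableT_comp.
  - apply: measurable_funeM; apply/measurable_EFinP.
    by apply: measurable_indic; exact: measurable_mball.
  move=> z _; rewrite -EFinM lee_fin indicE.
  have [zr|zr] := pselect (ball x1 r1 z).
    by rewrite mem_set // mulr1 lip0_bounded.
  by rewrite f_supp // normr0 mulr_ge0.
rewrite ge0_integralZl_EFin //; last first.
  by apply/measurable_EFinP; apply: measurable_indic; exact: measurable_mball.
rewrite integral_indic //; last exact: measurable_mball.
rewrite EFinM -volE ?r10 //; apply: lee_wpmul2l; first by rewrite lee_fin.
apply: le_measure; rewrite ?inE //.
- by apply: measurableI => //; exact: measurable_mball.
- exact: measurable_mball.
Qed.

Lemma avg_vanishes : vanishes_at_infinity avg.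
Proof.
move=> x e e0; have c0 := c_gt0; have b0 := bound_ge0.
have V1 : 0 < vol x1 r1 by apply: vol_gt0 => //; exact: r10.
pose K := (bound * vol x1 r1 + 1) / (c * e).
have K0 : 0 < K by rewrite divr_gt0 ?mulr_gt0 // ltr_wpDl // mulr_ge0 // ltW.
exists (K `^ Q^-1) => r Kr.
have r0 : 0 < r by apply: lt_le_trans Kr; exact: powR_gt0.
have V0 : 0 < vol x r by exact: vol_gt0.
have KQ : K <= r `^ Q.
  have -> : K = K `^ Q^-1 `^ Q by rewrite -powRrM mulVf ?powRr1 ?ltW // gt_eqF.
  by apply: ge0_ler_powR; rewrite ?nnegrE ?powR_ge0 ?(ltW Q_gt0) ?(ltW r0).
rewrite -(ler_pM2r V0); apply: le_trans (avg_vol_le x r0) _.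
apply: (@le_trans _ _ (e * (c * K))); last first.
  rewrite ler_pM2l //; apply: le_trans (vol_lower x r0).
  by rewrite ler_pM2l.
rewrite (_ : e * (c * K) = bound * vol x1 r1 + 1); first lra.
by rewrite /K; field; rewrite !gt_eqF.
Qed.

Definition slopes y : set R :=
  [set v | exists x r, [/\ 0 < r, mdist x y < r &
     v = r `^ (- s) * `|avg x r - avg x (2 * r)|]].

(** The supremum runs over all balls that contain [y], not only over those
    centered at [y]: this makes it lower semicontinuous. *)
Definition avg_gradient y : R := sup (slopes y).

Lemma slopes_neq0 y : slopes y !=set0.
Proof.
exists (1 `^ (- s) * `|avg y 1 - avg y (2 * 1)|), y, 1.
by split => //; rewrite mdistxx.
Qed.

(** For small radii by the Lipschitz condition and [s < 1], for large ones
    because [f] is bounded. *)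
Lemma slopes_bounded y : has_ubound (slopes y).
Proof.
have b0 := bound_ge0; have l0 := L0; have s0 := s_gt0; have s1 := s_lt1.
have avgb x r : 0 < r -> `|avg x r| <= bound + L * r.
  move=> r0; have := avg_close x r0; have := lip0_bounded x.
  have := ler_normB (f x) (f x - avg x r).
  by rewrite opprB addrC subrK; lra.
have avgB x r : 0 < r -> `|avg x r| <= bound.
  move=> r0; have V0 : 0 < vol x r by exact: vol_gt0.
  have mB := measurable_mball borelX x r.
  have i1 := integrable_ball x measurable_lipschitz lip0_bounded r0.
  have i4 : mu.-integrable (ball x r) (EFin \o (fun z => `|f z|)).
    by have := integrable_norm i1.
  rewrite /avg normrM normfV (gtr0_norm V0) ler_pdivrMr //.
  apply: le_trans (le_normr_Rintegral mB i1) _.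
  have i5 : mu.-integrable (ball x r) (EFin \o cst bound).
    apply: (@integrable_ball x r (cst bound) bound) => // z.
    by rewrite /= ger0_norm.
  apply: le_trans (le_Rintegral mB i4 i5 _) _.
    by move=> z _; exact: lip0_bounded.
  by rewrite Rintegral_cst.
exists (3 * L + 2 * bound) => _ [x [r [r0 xy ->]]].
have r20 : 0 < 2 * r by rewrite mulr_gt0.
have step1 : `|avg x r - avg x (2 * r)| <= 3 * L * r.
  have := avg_close x r0; have := avg_close x r20.
  have := ler_distD (f x) (avg x r) (avg x (2 * r)).
  by rewrite (distrC _ (f x)); lra.
have step2 : `|avg x r - avg x (2 * r)| <= 2 * bound.
  have := avgB x r r0; have := avgB x (2 * r) r20.
  by have := ler_normB (avg x r) (avg x (2 * r)); lra.
have [rl|rg] := leP r 1.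
  apply: (@le_trans _ _ (r `^ (- s) * (3 * L * r))).
    by rewrite ler_wpM2l ?powR_ge0.
  rewrite mulrCA -{2}[r]powRr1 ?(ltW r0) // -powRD; last first.
    by apply/implyP => _; rewrite gt_eqF.
  have h1 : r `^ (- s + 1) <= 1.
    rewrite -[leRHS](powRr0 r); apply: ger_powR; first by rewrite r0 rl.
    by lra.
  apply: (@le_trans _ _ (3 * L * 1)); last lra.
  by rewrite ler_wpM2l //; lra.
have h1 : r `^ (- s) <= 1.
  rewrite -[leRHS](powRr0 r); apply: ler_powR; [exact: ltW | lra].
apply: (@le_trans _ _ (1 * (2 * bound))); last lra.
by apply: ler_pM => //; exact: powR_ge0.
Qed.

Lemma avg_gradient_ge0 y : 0 <= avg_gradient y.
Proof.
have [v vy] := slopes_neq0 y; apply: (@le_trans _ _ v).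
  by have [x [r [_ _ ->]]] := vy; rewrite mulr_ge0 ?powR_ge0.
exact: ub_le_sup (slopes_bounded y) _ vy.
Qed.

(** Since the balls are open, a slope at [y] is a slope at all nearby points. *)
Lemma measurable_avg_gradient : measurable_fun setT avg_gradient.
Proof.
apply: measurable_fun_lsc => // a; rewrite openE => y /= ay.
have [v [x [r [r0 xy ->]]] av] := sup_gt (slopes_neq0 y) ay.
have : nbhs y (ball x r).
  by apply: open_nbhs_nbhs; split; [exact: open_mball | exact/in_ball].
apply: filterS => z /in_ball xz /=; apply: lt_le_trans av _.
by apply: ub_le_sup; [exact: slopes_bounded | exists x, r].
Qed.

Lemma fractional_gradient_avg : fractional_gradient s f avg avg_gradient.
Proof.
split.
- exact: avg_gradient_ge0.
- exact: measurable_avg_gradient.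
- move=> x y r r0 xy; rewrite -ler_pdivrMl ?powR_gt0 // -powRN.
  by apply: ub_le_sup; [exact: slopes_bounded | exists x, r].
move=> x e e0; have l0 := L0; exists (e / (L + 1)).
  by rewrite divr_gt0 //; lra.
move=> r r0; rewrite ler_pdivlMr; last lra.
by move=> re; apply: le_trans (avg_close x r0) _; lra.
Qed.

Definition pointwise_seminorm y : \bar R :=
  (\int[mu]_(z in ~` [set y])
     ((`|f y - f z| `^ t)%:E /
        ((mdist y z `^ (s * t))%:E * mu (ball y (mdist y z)))))%E.

(** On the ball the kernel of the seminorm is at least the inverse of
    [r ^ (s t) * vol y r], which bounds the integral of [|f y - f z| ^ t].  The
    passage to power [1] is by [u <= l + l ^ (1 - t) * u ^ t], integrated with
    the optimal [l]. *)
Lemma osc_seminorm_le y r G : 0 < r -> 0 < G ->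
  (pointwise_seminorm y <= G%:E)%E ->
  (\int[mu]_(z in ball y r) (`|f y - f z|)%:E <=
     (2 * (r `^ s * G `^ t^-1) * vol y r)%:E)%E.
Proof.
move=> r0 G0 hG; have t1 := t_ge1; have s0 := s_gt0; have t0 : 0 < t by lra.
have V0 : 0 < vol y r by exact: vol_gt0.
pose K := r `^ (s * t) * vol y r; have K0 : 0 < K by rewrite mulr_gt0 ?powR_gt0.
have mB := measurable_mball borelX y r.
have mo := measurable_osc y.
have mot : measurable_fun setT (fun z => (`|f y - f z| `^ t)%:E : \bar R).
  exact: measurable_powR_EFin.
have ot : (\int[mu]_(z in ball y r) (`|f y - f z| `^ t)%:E <= (K * G)%:E)%E.
  rewrite EFinM -lee_pdivrMl //.
  apply: le_trans hG; rewrite -integral_indicM.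
  rewrite -ge0_integralZl_EFin ?invr_ge0 ?(ltW K0) //; last first.
  - apply: emeasurable_funM => //; apply/measurable_EFinP.
    exact: measurable_indic.
  rewrite /pointwise_seminorm [leRHS]integral_mkcond.
  apply: ge0_le_integral_lower => z.
    by rewrite !mule_ge0 // ?lee_fin ?powR_ge0 ?invr_ge0 ?(ltW K0) // indicE ler0n.
  rewrite patchE; case: ifPn => [/set_mem /= zy|/negP]; last first.
    rewrite inE /= => /contrapT ->.
    by rewrite subrr normr0 powR0 ?mule0 // gt_eqF.
  have d0 : 0 < mdist y z by rewrite mdist_gt0; apply/eqP => e; apply: zy.
  rewrite volE // -EFinM inver gt_eqF ?mulr_gt0 ?powR_gt0 ?vol_gt0 // -EFinM.
  rewrite indicE; case: (pselect (ball y r z)) => [yz|yz]; last first.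
    rewrite memNset // mul0r mulr0 lee_fin.
    by rewrite mulr_ge0 ?powR_ge0 // invr_ge0 mulr_ge0 ?powR_ge0 // ltW ?vol_gt0.
  rewrite mem_set // mul1r lee_fin mulrC ler_wpM2l ?powR_ge0 //.
  have V1 : 0 < vol y (mdist y z) by exact: vol_gt0.
  rewrite lef_pV2 ?posrE ?mulr_gt0 ?powR_gt0 // /K.
  move/in_ball in yz.
  apply: ler_pM; rewrite ?powR_ge0 ?(ltW V1) //.
    by rewrite ge0_ler_powR ?nnegrE ?mulr_ge0 ?(ltW s0) ?(ltW t0) ?(ltW d0) ?(ltW r0) ?(ltW yz).
  by apply: le_vol => //; apply: ball_sub; rewrite mdistxx; lra.
pose l := r `^ s * G `^ t^-1; have l0 : 0 < l by rewrite mulr_gt0 ?powR_gt0.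
have lt : l `^ t = r `^ (s * t) * G.
  rewrite powRM ?powR_ge0 // -!powRrM mulVf ?powRr1 ?(ltW G0) // gt_eqF //.
have young u : 0 <= u -> u <= l + l `^ (1 - t) * u `^ t.
  move=> u0; have [ul|lu] := leP u l.
    by rewrite (le_trans ul) // lerDl mulr_ge0 ?powR_ge0.
  have {}u0 : 0 < u by lra.
  have -> : u `^ t = u * u `^ (t - 1).
    by rewrite mulr_powRB1 // ltW.
  rewrite (_ : 1 - t = - (t - 1)); last by ring.
  rewrite powRN; apply: le_trans (_ : l + u <= _); first by rewrite lerDr ltW.
  rewrite lerD2l mulrCA -[leLHS]mulr1 ler_pM2l // ler_pdivlMl ?powR_gt0 // mulr1.
  by rewrite ge0_ler_powR ?nnegrE ?(ltW l0) ?(ltW u0) ?(ltW lu) //; lra.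
have ll : 0 <= l `^ (1 - t) by exact: powR_ge0.
apply: (@le_trans _ _ (\int[mu]_(z in ball y r)
    (l%:E + (l `^ (1 - t))%:E * (`|f y - f z| `^ t)%:E))%E).
  apply: ge0_le_integral => //.
  - by apply: measurable_funTS; apply/measurable_EFinP.
  - apply: emeasurable_funD => //; apply: measurable_funeM.
    exact: measurable_funTS.
  by move=> z _; rewrite -EFinM -EFinD lee_fin young.
have motB : measurable_fun (ball y r)
    (fun z => (`|f y - f z| `^ t)%:E : \bar R) by exact: measurable_funTS.
have mlo : measurable_fun (ball y r)
    (fun z => (l `^ (1 - t))%:E * (`|f y - f z| `^ t)%:E)%E.
  exact: measurable_funeM.
have lo0 z : ball y r z -> (0 <= (l `^ (1 - t))%:E * (`|f y - f z| `^ t)%:E)%E.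
  by move=> _; rewrite mule_ge0 // lee_fin powR_ge0.
have lE0 z : ball y r z -> (0 <= l%:E)%E by move=> _; rewrite lee_fin ltW.
rewrite ge0_integralD // ge0_integralZl_EFin //.
rewrite (_ : (\int[mu]_(x in ball y r) l%:E) = (l * vol y r)%:E)%E; last first.
  by rewrite integral_cst // volE.
apply: le_trans (leeD2l _ (lee_wpmul2l _ ot)) _; first by rewrite lee_fin.
rewrite -EFinM -EFinD lee_fin le_eqVlt; apply/orP; left; apply/eqP.
have -> : l `^ (1 - t) * (K * G) = l * vol y r.
  rewrite /K (_ : _ * G = l `^ t * vol y r); last by rewrite lt; ring.
  rewrite mulrA -powRD; last by apply/implyP => _; rewrite gt_eqF.
  by rewrite subrK powRr1 // ltW.
by rewrite /l; ring.
Qed.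

(** Both averages are close to [f y], as their balls lie in [ball y (4 * r)] and
    have volumes comparable to it. *)
Lemma avg_gradient_le y G : 0 < G -> (pointwise_seminorm y <= G%:E)%E ->
  avg_gradient y <= 4 * 4 `^ s * CD ^+ 3 * G `^ t^-1.
Proof.
move=> G0 hG; have s0 := s_gt0.
have CD1 := CD_ge1 borelX mu_ball doublingCD.
apply: ge_sup; first exact: slopes_neq0.
move=> _ [x [r [r0 xy ->]]].
have r20 : 0 < 2 * r by rewrite mulr_gt0.
have r40 : 0 < 4 * r by rewrite mulr_gt0.
have V0 : 0 < vol x r by exact: vol_gt0.
have osc4 := osc_seminorm_le r40 G0 hG.
have Vy : vol y (4 * r) <= CD ^+ 3 * vol x r.
  by apply: (vol_compare borelX mu_ball doublingCD) => //; rewrite !exprS expr0; lra.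
set B := 2 * ((4 * r) `^ s * G `^ t^-1) * vol y (4 * r) in osc4.
have near r' : r <= r' -> r' <= 2 * r -> `|f y - avg x r'| <= B / vol x r.
  move=> rr' r'r; have r'0 : 0 < r' by lra.
  rewrite ler_pdivlMr //; apply: (@le_trans _ _ (`|f y - avg x r'| * vol x r')).
    rewrite ler_wpM2l //; apply: le_vol => //.
    by apply: ball_sub; rewrite mdistxx; lra.
  rewrite -lee_fin; apply: le_trans (avg_dist_le x y r'0) (le_trans _ osc4).
  apply: ge0_subset_integral => //.
  - exact: measurable_mball.
  - exact: measurable_mball.
  - by apply: measurable_funTS; apply/measurable_EFinP; exact: measurable_osc.
  by apply: ball_sub; rewrite metric_sym; lra.
rewrite powRN ler_pdivrMl ?powR_gt0 //.
apply: (@le_trans _ _ (2 * (B / vol x r))).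
  have := near r; have := near (2 * r).
  have := ler_distD (f y) (avg x r) (avg x (2 * r)).
  rewrite (distrC _ (f y)) => h1 h2 h3.
  have := h2 (ltac:(lra)) (ltac:(lra)); have := h3 (ltac:(lra)) (ltac:(lra)).
  lra.
rewrite mulrA ler_pdivrMr // /B powRM ?(ltW r0) //.
rewrite (_ : 2 * _ = 4 * 4 `^ s * r `^ s * G `^ t^-1 * vol y (4 * r)); last by ring.
rewrite (_ : _ * vol x r =
  4 * 4 `^ s * r `^ s * G `^ t^-1 * (CD ^+ 3 * vol x r)); last by ring.
by rewrite ler_wpM2l // !mulr_ge0 ?powR_ge0.
Qed.

End averages.

(** * The fractional Hardy-Sobolev inequality *)

(** The seminorm enters through an upper bound [J > 0] of its [p]-th power, which
    keeps the scaling in [J] a matter of positive real numbers. *)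
Lemma lip0_seminorm_inequality (R : realType) (d : measure_display)
    (X : measurableMetricType d R) (mu : {measure set X -> \bar R})
    (CD c Q CE rho s p q beta t : R) (E : set X) :
  borel_sigma_algebra X -> ball_measure_pos_fin mu ->
  (forall x r, 0 < r -> vol mu x (2 * r) <= CD * vol mu x r) ->
  0 < c -> (forall x r, 0 < r -> c * r `^ Q <= vol mu x r) ->
  E !=set0 -> closed E -> 1 <= CE -> 0 <= rho ->
  (forall e r r', E e -> 0 < r -> r < r' ->
    (mu (neighborhood E r `&` ball e r') <=
     (CE * (r / r') `^ rho * vol mu e r')%:E)%E) ->
  0 < s -> s < 1 -> 1 < p -> p <= q -> s * p < Q ->
  q <= Q * p / (Q - s * p) ->
  - (q / p * (Q - s * p + beta) - Q) < rho -> (0 <= beta -> 0 < rho) ->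
  1 <= t ->
  exists C : R, 0 < C /\ forall (f : X -> R) (J : R), Lip0 f -> 0 < J ->
  (\int[mu]_(y in [set: X])
     (pointwise_seminorm mu s t f y `^ (p / t) * dist_pow E beta y) <= J%:E)%E ->
  (\int[mu]_(x in [set: X])
     ((`|f x| `^ q)%:E * dist_pow E (q / p * (Q - s * p + beta) - Q) x) <=
   (C * J `^ (q / p))%:E)%E.
Proof.
move=> borelX mu_ball dbl c0 vlow E0 Ecl CE1 rho0 codimE s0 s1 p1 pq spQ qle
  rho_a rho_b t1.
have p0 : 0 < p by lra.
have t0 : 0 < t by lra.
have Q0 : 0 < Q by have := mulr_gt0 s0 p0; lra.
have [C [C0 HC]] := integral_dist_pow_le borelX mu_ball dbl c0 vlow E0 Ecl CE1
  rho0 codimE s0 p1 pq spQ qle rho_a rho_b.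
have CD1 := CD_ge1 borelX mu_ball dbl.
have CD0 : 0 < CD by lra.
pose K := 4 * 4 `^ s * CD ^+ 3.
have K0 : 0 < K by rewrite !mulr_gt0 ?powR_gt0 ?exprn_gt0.
have Kp0 : 0 < K `^ p by exact: powR_gt0.
exists (C * (K `^ p) `^ (q / p)); split; first by rewrite mulr_gt0 ?powR_gt0.
move=> f J [[L f_lip] [x1 [r1 [r10 f_supp]]]] J0 hJ.
have lip' x y : `|f x - f y| <= `|L| * mdist x y.
  by apply: le_trans (f_lip x y) _; rewrite ler_wpM2r ?mdist_ge0 // ler_norm.
have L0 : 0 <= `|L| by [].
have fg := fractional_gradient_avg borelX mu_ball s0 s1 L0 lip' r10 f_supp.
have van := avg_vanishes borelX mu_ball c0 vlow Q0 L0 lip' r10 f_supp.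
have mf := measurable_lipschitz borelX L0 lip'.
have [h0 mh _ _] := fg.
set h := avg_gradient mu s f in fg h0 mh.
have hG y : ((h y `^ p)%:E <=
    (K `^ p)%:E * pointwise_seminorm mu s t f y `^ (p / t))%E.
  have G0 : (0 <= pointwise_seminorm mu s t f y)%E.
    apply: integral_ge0 => z /= zy.
    have d0 : 0 < mdist y z by rewrite mdist_gt0; apply/eqP => e; apply: zy.
    rewrite volE // -EFinM inver gt_eqF ?mulr_gt0 ?powR_gt0 ?vol_gt0 //.
    rewrite -EFinM lee_fin mulr_ge0 ?powR_ge0 // invr_ge0.
    by rewrite mulr_ge0 ?powR_ge0 // ltW ?vol_gt0.
  have hle G : 0 < G -> (pointwise_seminorm mu s t f y <= G%:E)%E ->
      h y `^ t <= K `^ t * G.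
    move=> G_gt0 hG; have := avg_gradient_le borelX mu_ball dbl s0 t1 L0 lip'
      r10 f_supp G_gt0 hG.
    rewrite -/K -/h => hKG.
    have -> : K `^ t * G = (K * G `^ t^-1) `^ t.
      rewrite powRM ?powR_ge0 ?(ltW K0) // -powRrM mulVf ?gt_eqF //.
      by rewrite powRr1 // ltW.
    apply: ge0_ler_powR => //; first exact: ltW.
    - by rewrite nnegrE.
    - by rewrite nnegrE mulr_ge0 ?powR_ge0 // ltW.
  case: (pointwise_seminorm mu s t f y) G0 hle => [G| |] // G0 hle; last first.
    rewrite poweRyr ?gt_eqF ?divr_gt0 // gt0_muley ?lte_fin //.
    by rewrite leey.
  rewrite lee_fin in G0.
  (* A zero seminorm is reached as the limit of positive upper bounds. *)
  have htG : h y `^ t <= K `^ t * G.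
    apply/ler_addgt0Pr => e e0; have Kt0 : 0 < K `^ t by exact: powR_gt0.
    have G'0 : 0 < G + e / K `^ t by rewrite ltr_wpDl // divr_gt0.
    have := hle _ G'0; rewrite lee_fin lerDl divr_ge0 ?(ltW e0) ?(ltW Kt0) //.
    by move=> /(_ isT); rewrite mulrDr mulrCA divff ?gt_eqF // mulr1.
  rewrite poweR_EFin -EFinM lee_fin.
  have -> : h y `^ p = (h y `^ t) `^ (p / t).
    by rewrite -powRrM mulrCA divff ?gt_eqF // mulr1.
  have -> : K `^ p = (K `^ t) `^ (p / t).
    by rewrite -powRrM mulrCA divff ?gt_eqF // mulr1.
  rewrite -powRM ?powR_ge0 //; apply: ge0_ler_powR => //.
  - by rewrite divr_ge0 // ltW.
  - by rewrite nnegrE powR_ge0.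
  - by rewrite nnegrE mulr_ge0 // powR_ge0.
have hJ' : (\int[mu]_(y in [set: X]) ((h y `^ p)%:E * dist_pow E beta y) <=
    (K `^ p * J)%:E)%E.
  rewrite EFinM -lee_pdivrMl //; apply: le_trans hJ.
  have mhw : measurable_fun setT (fun y => (h y `^ p)%:E * dist_pow E beta y)%E.
    apply: emeasurable_funM; first exact: measurable_powR_EFin.
    exact: measurable_dist_pow.
  have hw0 y : (0 <= (h y `^ p)%:E * dist_pow E beta y)%E.
    by rewrite mule_ge0 ?dist_pow_ge0 // lee_fin powR_ge0.
  rewrite -ge0_integralZl_EFin ?invr_ge0 ?(ltW Kp0) //.
  apply: ge0_le_integral_lower => y.
    by rewrite mule_ge0 // lee_fin invr_ge0 ltW.
  rewrite muleA lee_wpmul2r ?dist_pow_ge0 //.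
  by rewrite lee_pdivrMl.
have KJ0 : 0 < K `^ p * J by rewrite mulr_gt0.
have := HC f _ h _ x1 r1 fg van mf f_supp KJ0 hJ'.
by rewrite powRM ?powR_ge0 ?(ltW J0) // mulrA.
Qed.

Unset Implicit Arguments.
Set Strict Implicit.

Theorem theorem5p3 (R : realType) (d : measure_display)
    (X : measurableMetricType d R) (mu : {measure set X -> \bar R})
    (borelX : borel_sigma_algebra X)
    (mu_ball : ball_measure_pos_fin mu)
    (mu_doubling : doubling mu)
    (X_unbounded : diam [set: X] = +oo%E)
    (mu_point : forall x : X, mu [set x] = 0%E)
    (annulus : forall (x : X) (r R0 : R), 0 < r -> r < R0 ->
      ball x R0 `\` ball x r !=set0)
    (s : R) (s_gt0 : 0 < s) (s_lt1 : s < 1)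
    (X_chain : chain_condition X 1)
    (mu_reverse : reverse_doubling mu s)
    (Q c : R) (Q_gts : s < Q) (c_gt0 : 0 < c)
    (mu_lower : forall (x : X) (r : R), 0 < r ->
      ((c * r `^ Q)%:E <= mu (ball x r))%E)
    (E : set X) (E_neq0 : E !=set0) (E_closed : closed E)
    (p q beta : R) (p_gt1 : 1 < p) (p_leq : p <= q)
    (sp_ltQ : s * p < Q) (q_le : q <= Q * p / (Q - s * p))
    (codimE : ((Num.max (Q - q / p * (Q - s * p + beta)) (beta / (p - 1)))%:E
                 < lower_assouad_codim mu E)%E)
    (t : R) (t_ge1 : 1 <= t) :
  exists C : R, 0 < C /\
    forall f : X -> R, Lip0 f ->
      (weighted_norm_lhs mu E Q s p q beta f <=
         C%:E * weighted_seminorm_rhs mu E s p t beta f)%E.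
Proof.
have p0 : 0 < p by lra.
have q0 : 0 < q by lra.
have [CD [CD0 dbl]] := mu_doubling.
have dbl' x r : 0 < r -> vol mu x (2 * r) <= CD * vol mu x r.
  by move=> r0; rewrite -lee_fin EFinM -!volE ?mulr_gt0 //; exact: dbl.
have vlow x r : 0 < r -> c * r `^ Q <= vol mu x r.
  by move=> r0; rewrite -lee_fin -volE //; exact: mu_lower.
have [_ [rho [rho0 [CE [CE1 hE]]] <-]] := ereal_sup_gt codimE.
rewrite lte_fin gt_max => /andP[rho_a rho_b].
have cod e r r' : E e -> 0 < r -> r < r' ->
    (mu (neighborhood E r `&` ball e r') <=
     (CE * (r / r') `^ rho * vol mu e r')%:E)%E.
  move=> Ee r0 rr'; have r'0 : 0 < r' by lra.
  have := hE e r r' Ee r0 rr'.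
  rewrite X_unbounded gt0_muley ?lte_fin // ltry => /(_ isT).
  by rewrite volE // inver gt_eqF ?vol_gt0 // lee_pdivrMr ?vol_gt0 // -EFinM.
have rho_pos : 0 <= beta -> 0 < rho.
  by move=> b0; apply: le_lt_trans rho_b; rewrite divr_ge0 //; lra.
have rho_a' : - (q / p * (Q - s * p + beta) - Q) < rho by rewrite opprB.
have [C [C0 HC]] := @lip0_seminorm_inequality R d X mu CD c Q CE rho s p q beta t E
  borelX mu_ball dbl' c_gt0 vlow E_neq0 E_closed CE1 rho0 cod s_gt0 s_lt1 p_gt1
  p_leq sp_ltQ q_le rho_a' rho_pos t_ge1.
have Cq0 : 0 < C `^ q^-1 by exact: powR_gt0.
exists (C `^ q^-1); split=> // f f0.
rewrite /weighted_norm_lhs /weighted_seminorm_rhs.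
set I := (\int[mu]_(x in _) ((`|f x| `^ q)%:E * _))%E.
set J := (\int[mu]_(y in [set: X]) (_ * dist_pow E beta y))%E.
have J0 : (0 <= J)%E.
  by apply: integral_ge0 => y _; rewrite mule_ge0 ?dist_pow_ge0 ?poweR_ge0.
have I0 : (0 <= I)%E.
  by apply: integral_ge0 => y _; rewrite mule_ge0 ?dist_pow_ge0 // lee_fin powR_ge0.
have bnd j : 0 < j -> (J <= j%:E)%E -> (I `^ q^-1 <= (C `^ q^-1 * j `^ p^-1)%:E)%E.
  move=> j0 Jj; have := HC f j f0 j0 Jj.
  have CJ : 0 <= C * j `^ (q / p) by rewrite mulr_ge0 ?powR_ge0 // ltW.
  move=> /(gt0_ler_poweR (r := q^-1)) h; apply: le_trans (h _ _ _) _.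
  - by rewrite invr_ge0 ltW.
  - by rewrite in_itv /= I0 leey.
  - by rewrite in_itv /= lee_fin CJ leey.
  rewrite poweR_EFin lee_fin powRM ?powR_ge0 ?(ltW C0) // -powRrM.
  by rewrite mulrAC divff ?gt_eqF // mul1r.
(* If the right-hand side vanishes, the bound holds for every positive number
in its place. *)
clearbody I J; case: J J0 bnd => [j| |] // J0 bnd; last first.
  by rewrite poweRyr ?gt_eqF ?invr_gt0 // gt0_muley ?lte_fin // leey.
rewrite lee_fin in J0; rewrite poweR_EFin -EFinM.
move: J0 bnd; rewrite le_eqVlt => /predU1P[<-|j0] bnd; last exact: bnd.
rewrite powR0 ?gt_eqF ?invr_gt0 // mulr0.
apply/lee_addgt0Pr => e e0; rewrite add0e.
have e1 : 0 < (e / C `^ q^-1) `^ p by rewrite powR_gt0 // divr_gt0.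
have e2 : (0%:E <= ((e / C `^ q^-1) `^ p)%:E)%E by rewrite lee_fin ltW.
apply: le_trans (bnd _ e1 e2) _.
rewrite lee_fin -powRrM mulfV ?gt_eqF // powRr1 ?divr_ge0 ?(ltW e0) ?(ltW Cq0) //.
by rewrite mulrC divfK // gt_eqF.
Qed.
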